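(* Let $m\le n$ be positive integers, let $(x_{ij})_{1\le i\le m,\,1\le j\le n}$ be a generic $m\times n$ matrix (its entries are independent variables), and let $I_m\subseteq\mathbb C[x_{ij}]$ be the ideal generated by its maximal minors $f_B$, where $B$ ranges over the $m$-element subsets of $\{1,\ldots,n\}$ and $f_B$ is the $m\times m$ minor with columns indexed by $B$. Then the polynomials $(f_B)_B$ (homogeneous of degree $m$ in $mn$ variables) have the polynomial PDE property. In particular, $b_{I_m}(-n)=0$, where $b_{I_m}(s)$ is the Bernstein-Sato polynomial of $I_m$.
   Context: Polynomial PDE property: homogeneous polynomials $f_1,\ldots,f_r\in\mathbb C[x_1,\ldots,x_N]$ of a common degree $d$ have the polynomial PDE property if there exist polynomials $P_\alpha\in\mathbb C[x_1,\ldots,x_N]$, indexed by $\alpha\in\mathbb Z_{\ge0}^r$, such that (1) $P_\alpha$ is homogeneous of degree $d(\alpha_1+\cdots+\alpha_r)$; (2) $P_0\ne0$; (3) $x_iP_\alpha=\sum_{k=1}^r(\partial_if_k)(\partial)P_{\alpha+e_k}$ for all $1\le i\le N$ and all $\alpha$. Here $e_k$ is the $k$-th standard basis vector, and $h(\partial)$ denotes the differential operator obtained from a polynomial $h$ by replacing each variable $x_j$ by $\partial_j=\partial/\partial x_j$, so $(\partial_if_k)(\partial)$ is obtained from $\partial f_k/\partial x_i$. Bernstein-Sato polynomial of an ideal (Budur-Mustata-Saito): let $D_x$ be the Weyl algebra of polynomial differential operators in $x_1,\ldots,x_N$. For a nonzero ideal $I\subseteq\mathbb C[x_1,\ldots,x_N]$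 choose nonzero generators $f_1,\ldots,f_r$, let $s_1,\ldots,s_r$ be independent variables, and let $f_1^{s_1}\cdots f_r^{s_r}$ be the formal generator of the free rank-one module over $\mathbb C[x_1,\ldots,x_N][f_1^{-1},\ldots,f_r^{-1},s_1,\ldots,s_r]$, on which $D_x[s_1,\ldots,s_r]$ acts in the obvious way. Then $b_I(s)$ is the monic polynomial of smallest degree such that $$b_I(s_1+\cdots+s_r)f_1^{s_1}\cdots f_r^{s_r}\in\sum_{u\in\mathbb Z^r,\ u_1+\cdots+u_r=1}D_x[s_1,\ldots,s_r]\cdot\Big(\prod_{u_i<0}\tbinom{s_i}{-u_i}\Big)f_1^{s_1+u_1}\cdots f_r^{s_r+u_r},$$ where $\binom{s_i}{m}=s_i(s_i-1)\cdots(s_i-m+1)/m!$. It exists and is independent of the chosen generators. *)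

(* Defs.v *)
From mathcomp Require Import all_boot all_order all_algebra.
From mathcomp.multinomials Require Export mpoly.
From mathcomp Require Export complex.
From mathcomp Require Export reals.

Set Implicit Arguments.
Unset Strict Implicit.
Unset Printing Implicit Defensive.

Import Order.TTheory GRing.Theory Num.Theory.
Local Open Scope ring_scope.

Section PolynomialPDE.
Variables (K : fieldType) (N : nat).

(* h(∂) q *)
Definition diff_op (h q : {mpoly K[N]}) : {mpoly K[N]} :=
  \sum_(a <- msupp h) h@_a *: q^`M[a].

Definition ffun_succ (I : finType) (k : I) (alpha : {ffun I -> nat}) :
    {ffun I -> nat} :=
  [ffun j => (alpha j + (j == k))%N].

Definition polynomial_pde (I : finType) (d : nat) (f : I -> {mpoly K[N]}) :
    Prop :=
  (forall k, f k \is d.-homog) /\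
  exists P : {ffun I -> nat} -> {mpoly K[N]},
    [/\ forall alpha, P alpha \is (d * \sum_k alpha k).-homog,
        P [ffun => 0%N] != 0
      & forall (i : 'I_N) alpha,
          'X_i * P alpha =
          \sum_k diff_op (f k)^`M(i) (P (ffun_succ k alpha))].

End PolynomialPDE.

Section Ideals.
Variable A : comNzRingType.

Definition ideal_gen (I : finType) (f : I -> A) (p : A) : Prop :=
  exists c : I -> A, p = \sum_k c k * f k.

Definition generates (I : finType) (f : I -> A) (J : A -> Prop) : Prop :=
  forall p, J p <-> ideal_gen f p.

End Ideals.

Section BernsteinSato.
Variables (K : fieldType) (N : nat).

Local Notation Rx := {mpoly K[N]}.
Local Notation Fx := {fraction {mpoly K[N]}}.
Local Notation "p %:F" := (@FracField.tofrac _ p).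

(* ∂_j on K(x), by the quotient rule. *)
Definition frac_deriv (j : 'I_N) (u : Fx) : Fx :=
  let p := (frac (repr u)).1 in
  let q := (frac (repr u)).2 in
  (p^`M(j) * q - p * q^`M(j))%:F / (q%:F) ^+ 2.

Section Family.
Variables (r : nat) (f : 'I_r -> Rx).

(* An element g of fs_module stands for g f_1^{s_1} ... f_r^{s_r}. The
   coefficients g range over K(x)[s_1, ..., s_r], which contains
   K[x][f_1^{-1}, ..., f_r^{-1}, s_1, ..., s_r] as a D_x[s_1, ..., s_r]-stable
   subspace as soon as the f_k are nonzero; the condition defining the
   Bernstein-Sato polynomial only involves elements of that subspace. *)
Definition fs_module := {mpoly Fx[r]}.

(* ∂_j (g f^s) = (∂_j g + g * \sum_k s_k (∂_j f_k) / f_k) f^s *)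
Definition fs_deriv (j : 'I_N) (g : fs_module) : fs_module :=
  map_mpoly (frac_deriv j) g +
  g * \sum_(k < r) (((f k)^`M(j))%:F / (f k)%:F)%:MP * 'X_k.

Definition fs_derivm (beta : 'X_{1..N}) (g : fs_module) : fs_module :=
  foldr (fun j => iter (beta j) (fs_deriv j)) g (enum 'I_N).

(* The elements of D_x[s_1, ..., s_r], written in normal order: P stands for
   \sum_beta P@_beta ∂^beta with coefficients P@_beta in K[x][s]. The
   (commutative) ring structure of this type is not the product of operators
   and is not used. *)
Definition weyl := {mpoly {mpoly Rx[r]}[N]}.

Definition weyl_act (P : weyl) (g : fs_module) : fs_module :=
  \sum_(beta <- msupp P)
    map_mpoly (fun c : Rx => c%:F) P@_beta * fs_derivm beta g.

(* binom(s_k, l) *)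
Definition s_binom (k : 'I_r) (l : nat) : fs_module :=
  ((l`!%:R : Fx)^-1) *: \prod_(i < l) ('X_k - i%:R).

(* (\prod_{u_k < 0} binom(s_k, -u_k)) f_1^{s_1 + u_1} ... f_r^{s_r + u_r} *)
Definition fs_shift (u : {ffun 'I_r -> int}) : fs_module :=
  (\prod_(k < r | u k < 0) s_binom k `|u k|%N) *
  (\prod_(k < r) (f k)%:F ^ u k)%:MP.

(* b(s_1 + ... + s_r) f_1^{s_1} ... f_r^{s_r} *)
Definition fs_eval (b : {poly K}) : fs_module :=
  (map_poly (fun c : K => ((c%:MP : Rx)%:F)%:MP : fs_module) b)
    .[\sum_(k < r) 'X_k].

Definition bernstein_sato_rel (b : {poly K}) : Prop :=
  exists (us : seq {ffun 'I_r -> int}) (P : {ffun 'I_r -> int} -> weyl),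
    (forall u, u \in us -> \sum_k u k = 1) /\
    fs_eval b = \sum_(u <- us) weyl_act (P u) (fs_shift u).

Definition bernstein_sato_family (b : {poly K}) : Prop :=
  [/\ b \is monic, bernstein_sato_rel b
    & forall c : {poly K}, c \is monic -> bernstein_sato_rel c ->
        (size b <= size c)%N].

End Family.

(* b is the Bernstein-Sato polynomial of the ideal J, computed from some choice
   of nonzero generators (it is independent of that choice). *)
Definition is_bernstein_sato (J : Rx -> Prop) (b : {poly K}) : Prop :=
  exists (r : nat) (f : 'I_r -> Rx),
    [/\ forall k, f k != 0, generates f J & bernstein_sato_family f b].

End BernsteinSato.

Section MaximalMinors.
Variables (K : fieldType) (m n : nat).

(* The variable x_ij is 'X_(mxvec_index i j). *)
Definition generic_mx : 'M[{mpoly K[m * n]}]_(m, n) :=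
  \matrix_(i, j) 'X_(mxvec_index i j).

Definition column_set := {B : {set 'I_n} | #|B| == m}.

(* enum_val lists the elements of B in increasing order. *)
Definition column_of (B : column_set) (k : 'I_m) : 'I_n :=
  enum_val (cast_ord (esym (eqP (valP B))) k).

Definition maximal_minor (B : column_set) : {mpoly K[m * n]} :=
  \det (colsub (column_of B) generic_mx).

Definition maximal_minor_ideal : {mpoly K[m * n]} -> Prop :=
  ideal_gen maximal_minor.

End MaximalMinors.

(* Main.v *)
Require Import Defs.
From HB Require Import structures.
From mathcomp Require Import all_boot all_order all_fingroup all_algebra.
From mathcomp Require Import generic_quotient ring zify.

(* Minors.  P_alpha is a scalar multiple of f^alpha.  The operators
   D_ij = sum_B (d_ij f_B)(d) f_B act on q = f^alpha, |alpha| = k, as a nonzero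
   scalar times x_ij, by a Capelli-type computation: eliminating one row a of the
   minor through sum_l d_(a,l) only uses that sum_l x_(c,l) d_(a,l) q is k q if
   c = a and 0 otherwise, and it contributes a factor n - p + k.

   Root.  The polynomial PDE says exactly that h d_t^alpha delta |-> h(d) P_alpha
   is a D-linear map phi from the direct image of K[x] along the graph of f to the
   Fourier transform of K[x].  By homogeneity phi vanishes on V^1 and, by Euler's
   identity, turns s_1 + ... + s_r into the scalar - N / d.  Hence a relation
   b(s) delta \in V^1 gives b(- N / d) P_0 = 0.  For other generators g of the same
   ideal, with f = c g, substitute d_(t_l) := sum_k c_kl d_(t_k); this is not
   D-linear, but the error terms have the form d_t t and preserve V^1. *)

Set Implicit Arguments.
Unset Strict Implicit.
Unset Printing Implicit Defensive.

Import Order.TTheory GRing.Theory Num.Theory.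
Local Open Scope ring_scope.

(** * Constant coefficient operators *)

Lemma mpoly_ind_mulX (A : comNzRingType) n (Q : {mpoly A[n]} -> Prop) :
  (forall p q, Q p -> Q q -> Q (p + q)) -> (forall c, Q c%:MP) ->
  (forall i p, Q p -> Q ('X_i * p)) -> forall p, Q p.
Proof.
move=> QD QC QX; elim/mpolyind=> [|c m p _ _ Qp]; first by rewrite -mpolyC0.
apply: QD Qp; rewrite (multinomUE_id m).
elim/big_rec: _ => [|i m' _]; first by rewrite mpolyX0 -mul_mpolyC mulr1.
elim: (m i) => [|k IHk] Qm; first by rewrite mulm0n add0m.
rewrite mulmS -addmA mpolyXD scalerAr.
exact/QX/IHk.
Qed.

Section LinearExtension.
Variables (A : nzRingType) (n : nat) (V : zmodType) (F : 'X_{1..n} -> A -> V).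
Hypothesis FD : forall m, {morph F m : x y / x + y}.

(** Only additivity of [F m] in the coefficient is assumed, so that the sums over [msupp] defining
    [diff_op], [pde_map] and [direct_image] are all instances. *)
Definition mlin (p : {mpoly A[n]}) : V := \sum_(m <- msupp p) F m p@_m.

Let F0 m : F m 0 = 0.
Proof. by apply: (addrI (F m 0)); rewrite -FD !addr0. Qed.

(** Additivity forces [F m 0 = 0], so monomials outside the support contribute nothing and several
    polynomials can be summed over a common list. *)
Lemma mlin_sub (s : seq 'X_{1..n}) p :
  uniq s -> {subset msupp p <= s} -> mlin p = \sum_(m <- s) F m p@_m.
Proof.
move=> uniq_s sub_s; rewrite [RHS](bigID (fun m => m \in msupp p)) /=.
rewrite [X in _ + X]big1 ?addr0 => [|m /memN_msupp_eq0 ->]; last exact: F0.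
rewrite -big_filter; apply: perm_big; apply: uniq_perm => [||m].
- exact: msupp_uniq.
- exact: filter_uniq.
by rewrite mem_filter; case: (boolP (m \in msupp p)) => // /sub_s ->.
Qed.

Lemma mlinD : {morph mlin : p q / p + q}.
Proof.
move=> p q; pose s := undup (msupp p ++ msupp q ++ msupp (p + q)).
have us : uniq s by exact: undup_uniq.
have [sp sq spq] : [/\ {subset msupp p <= s}, {subset msupp q <= s}
    & {subset msupp (p + q) <= s}].
  by split=> m m_in; rewrite mem_undup !mem_cat m_in ?orbT.
rewrite !(@mlin_sub s) //.
by rewrite -big_split /=; apply: eq_bigr => m _; rewrite mcoeffD FD.
Qed.

Lemma mlinZX c m : mlin (c *: 'X_[m]) = F m c.
Proof.
have [->|nz_c] := eqVneq c 0; first by rewrite scale0r /mlin msupp0 big_nil F0.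
by rewrite /mlin msuppMCX // big_seq1 mcoeffZ mcoeffX eqxx mulr1.
Qed.

Lemma mlin0 : mlin 0 = 0.
Proof. by rewrite /mlin msupp0 big_nil. Qed.

Lemma mlin_sum I (r : seq I) (Q : pred I) G :
  mlin (\sum_(i <- r | Q i) G i) = \sum_(i <- r | Q i) mlin (G i).
Proof. exact: (big_morph mlin mlinD mlin0). Qed.

Lemma mlinN : {morph mlin : p / - p}.
Proof. by move=> p; apply: (addrI (mlin p)); rewrite -mlinD !subrr mlin0. Qed.

Lemma mlinC c : mlin c%:MP = F 0%MM c.
Proof. by rewrite -[c%:MP]mulr1 mul_mpolyC -mpolyX0 mlinZX. Qed.

End LinearExtension.

Lemma mderivXU (A : nzRingType) n (i j : 'I_n) :
  ('X_i)^`M(j) = (i == j)%:R :> {mpoly A[n]}.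
Proof.
rewrite mderivX mnm1E; case: eqP => [->|_]; last by rewrite scale0r.
by rewrite scale1r -{1}[U_(j)%MM]add0m addmK mpolyX0.
Qed.

Section DiffOp.
Variables (K : fieldType) (N : nat).
Implicit Types (h p q : {mpoly K[N]}).

Let F q (m : 'X_{1..N}) (c : K) := c *: q^`M[m].
Let FD q m : {morph F q m : x y / x + y}.
Proof. by move=> x y; rewrite /F scalerDl. Qed.

Let diff_opE h q : diff_op h q = mlin (F q) h.
Proof. by []. Qed.

Lemma diff_opDl q : {morph (@diff_op K N)^~ q : h1 h2 / h1 + h2}.
Proof. exact: (mlinD (@FD q)). Qed.

Lemma diff_op0l q : diff_op 0 q = 0.
Proof. exact: (mlin0 (F q)). Qed.

Lemma diff_op_suml I (r : seq I) (Q : pred I) G q :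
  diff_op (\sum_(i <- r | Q i) G i) q = \sum_(i <- r | Q i) diff_op (G i) q.
Proof. exact: (mlin_sum (@FD q)). Qed.

Lemma diff_opZX c m q : diff_op (c *: 'X_[m]) q = c *: q^`M[m].
Proof. exact: (mlinZX (@FD q)). Qed.

Lemma diff_opC c q : diff_op c%:MP q = c *: q.
Proof. by rewrite diff_opE (mlinC (@FD q)) /F mderivm0m. Qed.

Lemma diff_op1 q : diff_op 1 q = q.
Proof. by rewrite diff_opC scale1r. Qed.

Lemma diff_op_is_linear h : linear (diff_op h).
Proof.
move=> c p q; rewrite /diff_op scaler_sumr -big_split; apply: eq_bigr => m _ /=.
by rewrite linearP scalerDr !scalerA mulrC.
Qed.
HB.instance Definition _ h := GRing.isLinear.Build K {mpoly K[N]} {mpoly K[N]}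
  *:%R (diff_op h) (diff_op_is_linear h).

Lemma diff_opXM i h q : diff_op ('X_i * h) q = diff_op h q^`M(i).
Proof.
elim/mpolyind: h => [|c m h _ _ IHh]; first by rewrite mulr0 !diff_op0l.
rewrite mulrDr !diff_opDl IHh -scalerAr -mpolyXD !diff_opZX.
by rewrite mderivmDm mderivmU1m.
Qed.

Lemma diff_opCM c h q : diff_op (c%:MP * h) q = c *: diff_op h q.
Proof.
elim/mpolyind: h => [|e m h _ _ IHh].
  by rewrite mulr0 diff_op0l scaler0.
by rewrite mulrDr !diff_opDl IHh mul_mpolyC scalerA !diff_opZX scalerDr scalerA.
Qed.

Lemma diff_opZl c h q : diff_op (c *: h) q = c *: diff_op h q.
Proof. by rewrite -mul_mpolyC diff_opCM. Qed.

Lemma mderiv_diff_op i h q : (diff_op h q)^`M(i) = diff_op h q^`M(i).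
Proof.
rewrite /diff_op linear_sum; apply: eq_bigr => m _ /=.
by rewrite mderivZ -!mderivmU1m -!mderivmDm addmC.
Qed.

Lemma diff_opM h1 h2 q : diff_op (h1 * h2) q = diff_op h1 (diff_op h2 q).
Proof.
elim/mpoly_ind_mulX: h1 q => [p p' IHp IHp'|c|i p IHp] q.
- by rewrite mulrDl !diff_opDl IHp IHp'.
- by rewrite diff_opCM diff_opC.
- by rewrite -mulrA !diff_opXM IHp mderiv_diff_op.
Qed.

(** The commutator of h(∂) with x_i is (∂_i h)(∂): this is differentiation by x_i seen through the
    Fourier transform. *)
Lemma diff_op_mulX h i q :
  diff_op h ('X_i * q) = 'X_i * diff_op h q + diff_op h^`M(i) q.
Proof.
elim/mpoly_ind_mulX: h q => [p p' IHp IHp'|c|j p IHp] q.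
- by rewrite mderivD !diff_opDl IHp IHp' mulrDr addrACA.
- by rewrite mderivC diff_op0l addr0 !diff_opC scalerAr.
rewrite !diff_opXM mderivM linearD /= IHp mderivM diff_opDl diff_opXM.
rewrite !mderivXU [j == i]eq_sym; case: (i == j).
  by rewrite !mul1r; ring.
by rewrite !mul0r linear0 diff_op0l !add0r.
Qed.

End DiffOp.

(** * Degree bounds and Euler's identity *)

Section DiffOpSize.
Variables (K : fieldType) (N : nat).
Implicit Types (h p q : {mpoly K[N]}).

Lemma msize_leP p k :
  reflect (forall m, m \in msupp p -> (mdeg m < k)%N) (msize p <= k)%N.
Proof.
apply: (iffP idP) => [le_pk m /msize_mdeg_lt /leq_trans->//|lt_k].
by rewrite msizeE; apply/bigmax_leqP_seq => m m_in _; exact: lt_k.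
Qed.

Lemma msize_mderivm m q : (msize q^`M[m] <= msize q - mdeg m)%N.
Proof.
apply/msize_leP => m'; rewrite mcoeff_msupp mcoeff_mderivm => nz.
have /msize_mdeg_lt : (m + m')%MM \in msupp q.
  by rewrite mcoeff_msupp; apply: contraNneq nz => ->; rewrite mul0rn.
by rewrite mdegD; lia.
Qed.

(** [msize] is the degree plus one, and 0 only for the zero polynomial, so the truncated subtraction
    also covers the case where h(∂) kills q. *)
Lemma msize_diff_op_homog d h q :
  h \is d.-homog -> (msize (diff_op h q) <= msize q - d)%N.
Proof.
move=> /dhomogP hom_h; rewrite /diff_op big_seq.
elim/big_ind: _ => [|p p' le_p le_p'|m /hom_h <-].
- by rewrite msize0.
- by apply: leq_trans (msizeD_le _ _) _; rewrite geq_max le_p le_p'.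
- exact: leq_trans (msizeZ_le _ _) (msize_mderivm _ _).
Qed.

Lemma msize_diff_op h q : (msize (diff_op h q) <= msize q)%N.
Proof.
rewrite /diff_op; elim/big_ind: _ => [|p p' le_p le_p'|m _].
- by rewrite msize0.
- by apply: leq_trans (msizeD_le _ _) _; rewrite geq_max le_p le_p'.
- by apply: leq_trans (msizeZ_le _ _) (leq_trans (msize_mderivm _ _) (leq_subr _ _)).
Qed.

Lemma euler_homog d p :
  p \is d.-homog -> \sum_i 'X_i * p^`M(i) = d%:R *: p.
Proof.
move=> /dhomogP hom_p.
have -> : p = \sum_(m <- msupp p) p@_m *: 'X_[m] by exact: mpolyE.
rewrite scaler_sumr; under eq_bigr do rewrite linear_sum mulr_sumr.
rewrite exchange_big /= big_seq [RHS]big_seq; apply: eq_bigr => m m_in.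
transitivity (\sum_i (p@_m * (m i)%:R) *: 'X_[m] : {mpoly K[N]}).
  apply: eq_bigr => i _; rewrite mderivZ mderivX scalerA -scalerAr -mpolyXD.
  have [->|nz] := eqVneq (m i) 0%N; first by rewrite mulr0 !scale0r.
  by rewrite addmC submK // lep1mP.
by rewrite -scaler_suml -mulr_sumr -natr_sum -mdegE (hom_p _ m_in) scalerA mulrC.
Qed.

End DiffOpSize.

(** * Direct images along graphs *)

(* On the direct image along the graph of c, with 'X_k standing for d/dt_k, nabla
   is d/dx_i (when D is d/dx_i on the coefficients), t_act is multiplication by
   t_k and s_act is - d/dt_k t_k: they are the conjugates by
   exp(- \sum_k c_k 'X_k) of D, of - d/d'X_k and of 'X_k d/d'X_k. They are locked
   because unification would otherwise unfold them to match sums and products. *)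
HB.lock Definition t_act (A : comNzRingType) r (c : 'I_r -> A) k
  (G : {mpoly A[r]}) : {mpoly A[r]} := c k *: G - G^`M(k).
HB.lock Definition s_act (A : comNzRingType) r (c : 'I_r -> A) k
  (G : {mpoly A[r]}) : {mpoly A[r]} := - ('X_k * t_act c k G).
HB.lock Definition nabla (A : comNzRingType) r (c : 'I_r -> A)
  (D : A -> A) (G : {mpoly A[r]}) : {mpoly A[r]} :=
  map_mpoly D G - (\sum_k D (c k) *: 'X_k) * G.

Section GraphOperators.
Variables (A : comNzRingType) (r : nat) (c : 'I_r -> A).
Implicit Types (G H : {mpoly A[r]}).

Local Notation t_act := (t_act c).
Local Notation s_act := (s_act c).

Fact t_act_is_linear k : linear (t_act k).
Proof.
move=> a G H; rewrite t_act.unlock mderivD mderivZ.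
rewrite !scalerDr scalerN !scalerA [a * _]mulrC.
by rewrite opprD addrACA.
Qed.
HB.instance Definition _ k := GRing.isLinear.Build A {mpoly A[r]} {mpoly A[r]}
  *:%R (t_act k) (t_act_is_linear k).

Fact s_act_is_linear k : linear (s_act k).
Proof.
move=> a G H; rewrite s_act.unlock [t_act _ _]linearP mulrDr -scalerAr opprD.
by rewrite scalerN.
Qed.
HB.instance Definition _ k := GRing.isLinear.Build A {mpoly A[r]} {mpoly A[r]}
  *:%R (s_act k) (s_act_is_linear k).

Lemma t_actX k l G : t_act k ('X_l * G) = 'X_l * t_act k G - (l == k)%:R *: G.
Proof.
rewrite t_act.unlock mderivM mderivXU mulrBr scalerAr opprD addrA addrAC.
by rewrite mulr_natl scaler_nat.
Qed.

Lemma s_actX k l G : s_act k ('X_l * G) = 'X_l * s_act k G + (l == k)%:R *: ('X_k * G).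
Proof.
by rewrite s_act.unlock t_actX mulrBr opprB [LHS]addrC -scalerAr mulrN mulrCA.
Qed.

(** Moving t_k past ∂_t^m produces the term with m_k; the other term comes from t_k acting on delta
    as c_k. *)
Lemma s_actZX k a m :
  s_act k (a *: 'X_[m]) = (m k)%:R *: (a *: 'X_[m]) - (a * c k) *: 'X_[m + U_(k)].
Proof.
rewrite s_act.unlock t_act.unlock mderivZ mderivX mulrBr opprB.
have -> : 'X_k * (c k *: (a *: 'X_[m])) = (a * c k) *: 'X_[m + U_(k)].
  by rewrite -!scalerAr -mpolyXD addmC scalerA mulrC.
have [->|nz] := eqVneq (m k) 0%N; first by rewrite !scale0r scaler0 mulr0.
by rewrite -!scalerAr -mpolyXD addmC submK ?lep1mP // !scalerA mulrC.
Qed.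

(** Every variable has the same weight one for s_1 + ... + s_r, which is why the sum is compatible
    with linear changes of the variables. *)
Lemma sum_s_actX l G :
  \sum_k s_act k ('X_l * G) = 'X_l * (\sum_k s_act k G) + 'X_l * G.
Proof.
under eq_bigr do rewrite s_actX; rewrite big_split mulr_sumr /=; congr (_ + _).
rewrite (bigD1 l) //= eqxx scale1r big1 ?addr0 // => k /negbTE.
by rewrite eq_sym => ->; rewrite scale0r.
Qed.

Lemma t_actC k l G : t_act k (t_act l G) = t_act l (t_act k G).
Proof.
rewrite t_act.unlock !linearB !linearZ /= mderiv_comm !scalerA.
by rewrite [c l * _]mulrC; ring.
Qed.

Lemma s_actC k l G : s_act k (s_act l G) = s_act l (s_act k G).
Proof.
have [->//|nlk] := eqVneq l k.
rewrite s_act.unlock !linearN /= !mulrN !opprK !t_actX [k == l]eq_sym (negbTE nlk).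
by rewrite !scale0r !subr0 (t_actC k l) mulrCA.
Qed.

Variable D : {additive A -> A}.
Hypothesis DM : forall x y, D (x * y) = D x * y + x * D y.

Local Notation nabla := (nabla c D).

Fact nabla_is_additive : additive nabla.
Proof.
by move=> G H; rewrite nabla.unlock raddfB /=; ring.
Qed.
HB.instance Definition _ := GRing.isAdditive.Build {mpoly A[r]} {mpoly A[r]}
  nabla nabla_is_additive.

Lemma nablaD : {morph nabla : G H / G + H}. Proof. exact: raddfD. Qed.
Lemma nabla_sum I (s : seq I) (Q : pred I) (G : I -> {mpoly A[r]}) :
  nabla (\sum_(i <- s | Q i) G i) = \sum_(i <- s | Q i) nabla (G i).
Proof. exact: raddf_sum. Qed.

Lemma map_mpoly_derZ a G :
  map_mpoly D (a *: G) = D a *: G + a *: map_mpoly D G.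
Proof.
by apply/mpolyP => m; rewrite mcoeff_map_mpoly mcoeffD !mcoeffZ mcoeff_map_mpoly DM.
Qed.

Lemma nablaZ a G : nabla (a *: G) = D a *: G + a *: nabla G.
Proof. by rewrite nabla.unlock map_mpoly_derZ scalerBr -scalerAr addrA. Qed.

Lemma nabla_mpolyX m :
  nabla 'X_[m] = - \sum_k D (c k) *: 'X_[m + U_(k)].
Proof.
rewrite nabla.unlock (_ : map_mpoly D _ = 0) ?sub0r.
  congr (- _); rewrite mulr_suml; apply: eq_bigr => k _.
  by rewrite -scalerAl -mpolyXD addmC.
have D1 : D 1 = 0.
  by apply: (addrI (D 1)); rewrite addr0 -[in RHS](mulr1 1) DM mulr1 mul1r.
apply/mpolyP => m'; rewrite mcoeff_map_mpoly mcoeffX mcoeff0.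
by case: eqP => _; rewrite ?raddf0.
Qed.

Lemma nablaC a : nabla a%:MP = (D a)%:MP - \sum_k (a * D (c k)) *: 'X_k.
Proof.
rewrite nabla.unlock map_mpolyC mulrC mul_mpolyC scaler_sumr.
by congr (_ - _); apply: eq_bigr => k _; rewrite scalerA.
Qed.

Lemma map_mpoly_derX l G : map_mpoly D ('X_l * G) = 'X_l * map_mpoly D G.
Proof.
apply/mpolyP => m; rewrite mcoeff_map_mpoly !['X_l * _]mulrC.
have [le_lm|] := boolP (U_(l) <= m)%MM.
  by rewrite -(submK le_lm) addmC !mcoeffMX mcoeff_map_mpoly.
have coef0 H : ~~ (U_(l) <= m)%MM -> (H * 'X_l)@_m = 0.
  move=> nle; apply/memN_msupp_eq0; apply: contra nle.
  by rewrite (perm_mem (msuppMX _ _)) => /mapP [m' _ ->]; exact: lem_addr.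
by move=> nle; rewrite !coef0 // raddf0.
Qed.

Lemma nablaX l G : nabla ('X_l * G) = 'X_l * nabla G.
Proof. by rewrite nabla.unlock map_mpoly_derX mulrBr mulrCA. Qed.

Lemma map_mpoly_der_mderiv k G : map_mpoly D G^`M(k) = (map_mpoly D G)^`M(k).
Proof.
by apply/mpolyP => m; rewrite mcoeff_map_mpoly !mcoeff_deriv mcoeff_map_mpoly raddfMn.
Qed.

(** The term D(c_k) G arises on both sides: on the left from [mderiv k] of the linear form in the
    variables, on the right from Leibniz on c_k G. *)
Lemma t_act_nabla k G : t_act k (nabla G) = nabla (t_act k G).
Proof.
have dw : (\sum_l D (c l) *: 'X_l)^`M(k) = (D (c k))%:MP :> {mpoly A[r]}.
  rewrite linear_sum /= (bigD1 k) //= big1 => [|l nlk].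
    by rewrite addr0 mderivZ mderivXU eqxx -mul_mpolyC mulr1.
  by rewrite mderivZ mderivXU (negbTE nlk) scaler0.
rewrite [in RHS]t_act.unlock [RHS]raddfB /= [in RHS]nablaZ t_act.unlock nabla.unlock.
rewrite mderivB mderivM dw.
rewrite map_mpoly_der_mderiv mul_mpolyC.
set w := \sum_l _; move: (map_mpoly _ G) (G^`M(k)) => G1 G2.
rewrite scalerBr scalerAr !opprB.
move: (D _ *: G) (w * _) (w * _) (c k *: _) => x1 x2 x3 x4; ring.
Qed.

Lemma s_act_nabla k G : s_act k (nabla G) = nabla (s_act k G).
Proof. by rewrite s_act.unlock t_act_nabla -nablaX raddfN. Qed.

End GraphOperators.

(** * The D-linear map attached to a solution of the polynomial PDE *)

Section PolynomialPDEFunctional.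
Variables (K : fieldType) (N r d : nat).
Local Notation Rx := {mpoly K[N]}.
Variables (f : 'I_r -> Rx) (P : 'X_{1..r} -> Rx).
Hypothesis f_homog : forall k, f k \is d.-homog.
Hypothesis P_homog : forall a, P a \is (d * mdeg a).-homog.
Hypothesis P_pde : forall (i : 'I_N) a,
  'X_i * P a = \sum_k diff_op (f k)^`M(i) (P (a + U_(k))%MM).

Let F (a : 'X_{1..r}) (h : Rx) := diff_op h (P a).
Let FD a : {morph F a : x y / x + y}.
Proof. by move=> x y; apply: diff_opDl. Qed.

(* The D-linear map to the Fourier transform of K[x], on which d/dx_i acts as
   multiplication by - x_i. *)
Definition pde_map (G : {mpoly Rx[r]}) : Rx :=
  \sum_(a <- msupp G) diff_op G@_a (P a).

Lemma pde_mapD : {morph pde_map : G H / G + H}.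
Proof. exact: (mlinD FD). Qed.

Lemma pde_mapN : {morph pde_map : G / - G}.
Proof. exact: (mlinN FD). Qed.

Lemma pde_map0 : pde_map 0 = 0.
Proof. exact: (mlin0 F). Qed.

Lemma pde_map_sum I (s : seq I) (Q : pred I) G :
  pde_map (\sum_(i <- s | Q i) G i) = \sum_(i <- s | Q i) pde_map (G i).
Proof. exact: (mlin_sum FD). Qed.

Lemma pde_mapZX h a : pde_map (h *: 'X_[a]) = diff_op h (P a).
Proof. exact: (mlinZX FD). Qed.

Lemma pde_mapZ h G : pde_map (h *: G) = diff_op h (pde_map G).
Proof.
elim/mpolyind: G => [|e a G _ _ IH]; first by rewrite scaler0 pde_map0 linear0.
by rewrite scalerDr !pde_mapD linearD IH scalerA !pde_mapZX diff_opM.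
Qed.

(** On h X^a, [nabla] gives (∂_i h) X^a minus terms whose images add up, by the PDE, to h(∂)(x_i
    P_a). The commutator of h(∂) and x_i then cancels (∂_i h)(∂) P_a. *)
Lemma pde_map_nabla i G : pde_map (nabla f (mderiv i) G) = - 'X_i * pde_map G.
Proof.
elim/mpolyind: G => [|h a G _ _ IH]; first by rewrite raddf0 pde_map0 mulr0.
rewrite nablaD !pde_mapD IH mulrDr; congr (_ + _).
rewrite nablaZ; last exact: mderivM.
rewrite nabla_mpolyX; last exact: mderivM.
rewrite scalerN scaler_sumr pde_mapD pde_mapN pde_map_sum pde_mapZX.
under eq_bigr do rewrite scalerA pde_mapZX diff_opM.
rewrite -linear_sum /= -P_pde diff_op_mulX pde_mapZX mulNr.
by rewrite opprD addrCA subrr addr0.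
Qed.

(** Apply ∂_i to the i-th equation and sum over i. Euler's identity for P_a yields N + d |a|;
    Euler's identity for f_k turns the sum of x_i ∂_i f_k into d f_k. *)
Lemma euler_pde a : \sum_k d%:R *: diff_op (f k) (P (a + U_(k))%MM) =
  (N + d * mdeg a)%:R *: P a.
Proof.
transitivity (\sum_(i < N) ('X_i * P a)^`M(i)).
  under [RHS]eq_bigr do rewrite P_pde linear_sum.
  rewrite exchange_big; apply: eq_bigr => k _ /=.
  under [RHS]eq_bigr do rewrite mderiv_diff_op -diff_opXM.
  rewrite -diff_op_suml (euler_homog (f_homog k)).
  by rewrite diff_opZl.
under eq_bigr do rewrite mderivM mderivXU eqxx mul1r.
rewrite big_split /= (euler_homog (P_homog a)) sumr_const card_ord.
by rewrite -[in LHS]scaler_nat -scalerDl -natrD.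
Qed.

(** On h X^a the weights a_k add up to |a|, and d |a| cancels against the same term in [euler_pde],
    leaving - N. *)
Lemma pde_map_s_act G :
  d%:R *: pde_map (\sum_k s_act f k G) = - N%:R *: pde_map G.
Proof.
elim/mpolyind: G => [|h a G _ _ IH].
  by rewrite big1 => [|k _]; rewrite ?linear0 // pde_map0 !scaler0.
under eq_bigr do rewrite linearD.
rewrite big_split !pde_mapD !scalerDr /= IH; congr (_ + _).
under eq_bigr do rewrite s_actZX.
rewrite sumrB pde_mapD pde_mapN !pde_map_sum.
under eq_bigr do rewrite pde_mapZ pde_mapZX.
under [X in _ - X]eq_bigr do rewrite pde_mapZX diff_opM.
rewrite -[X in _ - X]linear_sum scalerBr /= -[X in _ - X]linearZ /=.
rewrite [in X in _ - X]scaler_sumr euler_pde pde_mapZX linearZ /=.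
under eq_bigr do rewrite -mpolyC_nat diff_opC.
rewrite -scaler_suml -natr_sum -mdegE scalerA -natrM -scalerBl.
by rewrite natrD opprD addrCA subrr addr0.
Qed.

End PolynomialPDEFunctional.

(** * Change of generators *)

(** When f = cc g, this substitution carries the linear form [\sum_l g l *: 'X_l] to
    [\sum_k f k *: 'X_k]. *)
HB.lock Definition change_family (A : comNzRingType) r r'
  (cc : 'I_r -> 'I_r' -> A) (G : {mpoly A[r']}) : {mpoly A[r]} :=
  G \mPo [tuple \sum_k cc k l *: 'X_k | l < r'].

Section ChangeOfFamily.
Variables (A : comNzRingType) (r r' : nat).
Variables (f : 'I_r -> A) (g : 'I_r' -> A) (cc : 'I_r -> 'I_r' -> A).
Hypothesis f_g : forall k, f k = \sum_l cc k l * g l.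

Local Notation sigma := (change_family cc).

Fact change_family_is_linear : linear sigma.
Proof. by move=> a G H; rewrite change_family.unlock linearP. Qed.
HB.instance Definition _ := GRing.isLinear.Build A {mpoly A[r']} {mpoly A[r]}
  *:%R sigma change_family_is_linear.

Lemma change_familyC a : sigma a%:MP = a%:MP.
Proof. by rewrite change_family.unlock comp_mpolyC. Qed.

Lemma change_familyX l : sigma 'X_l = \sum_k cc k l *: 'X_k.
Proof. by rewrite change_family.unlock comp_mpolyXU -tnth_nth tnth_mktuple. Qed.

Lemma change_familyXM l G : sigma ('X_l * G) = (\sum_k cc k l *: 'X_k) * sigma G.
Proof. by rewrite -change_familyX change_family.unlock rmorphM. Qed.

(** On constants both sides are linear forms matched by f = cc g; multiplication by a variable
    shifts both sums by the same weight one. *)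
Lemma change_family_s_act G :
  sigma (\sum_l s_act g l G) = \sum_k s_act f k (sigma G).
Proof.
elim/mpoly_ind_mulX: G => [G H IHG IHH|a|l G IH].
- under eq_bigr do rewrite linearD; rewrite big_split !linearD /= IHG IHH.
  by rewrite -big_split; apply: eq_bigr => k _; rewrite linearD.
- rewrite change_familyC.
  have s_actC' s (c : 'I_s -> A) k : s_act c k a%:MP = - ((a * c k) *: 'X_k).
    by rewrite -[a%:MP]mulr1 mul_mpolyC -mpolyX0 s_actZX mnm0E scale0r sub0r add0m.
  under eq_bigr do rewrite s_actC'; under [RHS]eq_bigr do rewrite s_actC'.
  rewrite !sumrN linearN linear_sum.
  congr (- _).
  under eq_bigr do rewrite linearZ /= change_familyX scaler_sumr.
  rewrite exchange_big; apply: eq_bigr => k _ /=.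
  under eq_bigr do rewrite scalerA.
  rewrite -scaler_suml f_g mulr_sumr; congr (_ *: _); apply: eq_bigr => l _.
  by ring.
rewrite sum_s_actX linearD /= !change_familyXM IH mulr_suml.
under [RHS]eq_bigr do rewrite mulr_suml linear_sum.
rewrite exchange_big mulr_suml -big_split; apply: eq_bigr => k _ /=.
under [RHS]eq_bigr do rewrite -scalerAl linearZ /=.
by rewrite -scaler_sumr sum_s_actX scalerDr -!scalerAl.
Qed.

Variable D : {additive A -> A}.
Hypothesis DM : forall x y, D (x * y) = D x * y + x * D y.

(** The error terms, of the form ∂_t t, come from differentiating the coefficients cc, which depend
    on x. *)
Lemma change_family_nabla G :
  sigma (nabla g D G) = nabla f D (sigma G) +
    \sum_k \sum_l D (cc k l) *: ('X_k * sigma (t_act g l G)).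
Proof.
elim/mpoly_ind_mulX: G => [G H IHG IHH|a|l G IH].
- rewrite nablaD !linearD /= nablaD IHG IHH addrACA; congr (_ + _).
  rewrite -big_split; apply: eq_bigr => k _; rewrite -big_split.
  by apply: eq_bigr => l _; rewrite !linearD /= mulrDr scalerDr.
- rewrite change_familyC !nablaC linearB /= change_familyC -addrA; congr (_ + _).
  (* Collect the terms in g on one side: they form the Leibniz expansion of D (cc k l * g l), whose
     sum over l is D (f k). *)
  rewrite addrC; apply/eqP; rewrite -subr_eq opprK addrC subr_eq; apply/eqP.
  rewrite linear_sum /=.
  under [X in _ + X]eq_bigr do rewrite linearZ /= change_familyX scaler_sumr.
  rewrite [X in _ + X]exchange_big.
  rewrite -big_split; apply: eq_bigr => k _ /=.
  under eq_bigr do rewrite t_act.unlock mderivC subr0 linearZ /=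
    change_familyC -scalerAr mulrC mul_mpolyC !scalerA.
  under [X in _ + X]eq_bigr do rewrite scalerA.
  rewrite -!scaler_suml -scalerDl -big_split; congr (_ *: _).
  rewrite f_g raddf_sum mulr_sumr; apply: eq_bigr => l _ /=.
  by rewrite DM; ring.
set w := \sum_k cc k l *: 'X_k : {mpoly A[r]}.
have nabla_w H : nabla f D (w * H) =
    w * nabla f D H + \sum_k D (cc k l) *: ('X_k * H).
  rewrite mulr_suml nabla_sum mulr_suml -big_split; apply: eq_bigr => k _ /=.
  by rewrite -!scalerAl nablaZ // nablaX addrC.
rewrite nablaX !change_familyXM IH -/w nabla_w mulrDr -addrA; congr (_ + _).
rewrite mulr_sumr -big_split; apply: eq_bigr => k _ /=.
under [in RHS]eq_bigr do rewrite t_actX linearB linearZ /=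
  change_familyXM -/w mulrBr scalerBr.
rewrite sumrB addrC mulr_sumr.
(* The commutator of t_l' with ['X_l] survives only for l' = l, where it cancels the derivative of w
   found in [nabla_w]. *)
have -> : \sum_l' D (cc k l') *: ('X_k * ((l == l')%:R *: sigma G)) =
    D (cc k l) *: ('X_k * sigma G).
  rewrite (bigD1 l) //= eqxx scale1r big1 ?addr0 // => l' /negbTE.
  by rewrite eq_sym => ->; rewrite scale0r mulr0 scaler0.
rewrite subrK; apply: eq_bigr => l' _.
by rewrite -scalerAr mulrCA.
Qed.

End ChangeOfFamily.

(** * Vanishing of the map on the V-filtration *)

Section Vanishing.
Variables (K : fieldType) (N r r' d : nat).
Local Notation Rx := {mpoly K[N]}.
Variables (f : 'I_r -> Rx) (P : 'X_{1..r} -> Rx).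
Hypothesis f_homog : forall k, f k \is d.-homog.
Hypothesis P_homog : forall a, P a \is (d * mdeg a).-homog.
Hypothesis P_pde : forall (i : 'I_N) a,
  'X_i * P a = \sum_k diff_op (f k)^`M(i) (P (a + U_(k))%MM).
Variables (g : 'I_r' -> Rx) (cc : 'I_r -> 'I_r' -> Rx) (aa : 'I_r' -> 'I_r -> Rx).
Hypothesis f_g : forall k, f k = \sum_l cc k l * g l.
Hypothesis g_f : forall l, g l = \sum_k aa l k * f k.

Local Notation phi := (pde_map P).
Local Notation sigma := (change_family cc).

Definition t_acts (s : seq 'I_r') (G : {mpoly Rx[r']}) :=
  foldl (fun H l => t_act g l H) G s.

(* j is a lower bound for the order of G in the V-filtration *)
Definition vanishing (j : nat) (G : {mpoly Rx[r']}) : Prop :=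
  forall s a, (mdeg a < j + size s)%N -> phi ('X_[a] * sigma (t_acts s G)) = 0.

Lemma t_acts_cons l s G : t_acts (l :: s) G = t_acts s (t_act g l G).
Proof. by []. Qed.

Lemma t_actsD s : {morph t_acts s : G H / G + H}.
Proof. by elim: s => [|l s IHs] G H //=; rewrite linearD IHs. Qed.

Lemma t_actsZ s h G : t_acts s (h *: G) = h *: t_acts s G.
Proof. by elim: s G => [|l s IHs] G //=; rewrite linearZ IHs. Qed.

Lemma t_acts_nabla s i G :
  t_acts s (nabla g (mderiv i) G) = nabla g (mderiv i) (t_acts s G).
Proof. by elim: s G => [|l s IHs] G //=; rewrite t_act_nabla ?IHs //; exact: mderivM. Qed.

Lemma t_acts_t_act s l G : t_acts s (t_act g l G) = t_act g l (t_acts s G).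
Proof. by elim: s G => [|l' s IHs] G //=; rewrite t_actC IHs. Qed.

Lemma vanishingD j G H : vanishing j G -> vanishing j H -> vanishing j (G + H).
Proof.
move=> vG vH s a lt_a; rewrite t_actsD linearD /= mulrDr pde_mapD.
by rewrite vG ?vH ?addr0.
Qed.

Lemma vanishingZ j h G : vanishing j G -> vanishing j (h *: G).
Proof.
move=> vG s a lt_a; rewrite t_actsZ linearZ /= -scalerAr pde_mapZ.
by rewrite vG ?linear0.
Qed.

Lemma vanishing0 j : vanishing j 0.
Proof.
move=> s a _; rewrite -(scale0r 0) t_actsZ linearZ /= -scalerAr pde_mapZ.
by rewrite diff_op0l.
Qed.

Lemma vanishing_t_act j l G : vanishing j G -> vanishing j.+1 (t_act g l G).
Proof. by move=> vG s a lt_a; rewrite (vG (l :: s)) //= addnS. Qed.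

Lemma vanishing_mulX j l G : vanishing j.+1 G -> vanishing j ('X_l * G).
Proof.
move=> vG s; elim: s j G vG => [|l' s IHs] j G vG a lt_a.

  rewrite change_familyXM mulr_suml mulr_sumr pde_map_sum big1 // => k _.
  rewrite -!scalerAl -scalerAr mulrA -mpolyXD pde_mapZ (vG [::]) ?linear0 //.
  by rewrite mdegD mdeg1; lia.
rewrite t_acts_cons t_actX t_actsD linearD /= mulrDr.
(* In the first term t_l' has raised the order of G by one. In the second the commutator has used up
   t_l', and the extra order assumed of G makes up for it. *)
rewrite pde_mapD (IHs j.+1) ?add0r.
- rewrite -scaleNr t_actsZ linearZ /= -scalerAr pde_mapZ vG ?linear0 //.
  by move: lt_a => /=; lia.
- exact: vanishing_t_act.
- by move: lt_a => /=; lia.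
Qed.

Lemma vanishing_s_act j l G : vanishing j G -> vanishing j (s_act g l G).
Proof.
move=> vG; rewrite s_act.unlock -scaleN1r; apply: vanishingZ.
exact/vanishing_mulX/vanishing_t_act.
Qed.

(** The map turns the main term into a multiple of - x_i; each error term has one more ∂_t and one
    more t, which balance in the inequality defining [vanishing]. *)
Lemma vanishing_nabla j i G : vanishing j G -> vanishing j (nabla g (mderiv i) G).
Proof.
move=> vG s a lt_a; rewrite t_acts_nabla (change_family_nabla f_g); last first.
  exact: mderivM.
rewrite mulrDr pde_mapD mulr_sumr pde_map_sum [X in _ + X]big1 => [|k _].
  have nabla_mX H : 'X_[a] * nabla f (mderiv i) H = nabla f (mderiv i) ('X_[a] * H).
    rewrite mpolyXE_id; elim/big_ind: _ H => [H|x y IHx IHy H|k _ H].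
    - by rewrite !mul1r.
    - by rewrite -!mulrA IHy IHx.
    elim: (a k) H => [|e IHe] H; first by rewrite !expr0 !mul1r.
    by rewrite exprS -!mulrA nablaX IHe.
  by rewrite addr0 nabla_mX (pde_map_nabla P_pde) vG ?mulr0.
rewrite mulr_sumr pde_map_sum big1 // => l _.
rewrite -scalerAr pde_mapZ mulrA -mpolyXD -t_acts_t_act (vG (l :: s)) ?linear0 //.
by rewrite mdegD mdeg1 /=; lia.
Qed.

Hypothesis d_gt0 : (0 < d)%N.

Lemma msize_diff_op_g l q : (msize (diff_op (g l) q) <= msize q - d)%N.
Proof.
rewrite g_f diff_op_suml; apply: leq_trans (msize_sum _ _ _) _.
apply/bigmax_leqP => k _; rewrite diff_opM.
by apply: leq_trans (msize_diff_op _ _) (msize_diff_op_homog _ (f_homog k)).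
Qed.

(** A word of t's turns 1 into a product of as many g's, and each g(∂) lowers the degree by at least
    d. Since P_a has degree d |a| with |a| less than the length of the word, it is killed. *)
Lemma vanishing1 : vanishing 0 1.
Proof.
move=> s a; rewrite add0n.
have -> : t_acts s 1 = (\prod_(l <- s) g l)%:MP.
  elim/last_ind: s => [|s l IHs]; first by rewrite big_nil mpolyC1.
  rewrite /t_acts foldl_rcons -/(t_acts s 1) IHs big_rcons /= t_act.unlock.
  by rewrite mderivC subr0 -mul_mpolyC mpolyCM mulrC.
rewrite change_familyC mulrC mul_mpolyC pde_mapZX => lt_a.
apply/eqP; rewrite -msize_poly_eq0 -leqn0.
have size_prod q : (msize (diff_op (\prod_(l <- s) g l) q) <= msize q - d * size s)%N.
  elim: s {lt_a} => [|l s IHs]; first by rewrite big_nil diff_op1 muln0 subn0.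
  rewrite big_cons diff_opM (leq_trans (msize_diff_op_g _ _)) //= mulnS.
  by rewrite (leq_trans (leq_sub2r _ IHs)) // -subnDA addnC.
apply: leq_trans (size_prod _) _; rewrite leqn0 subn_eq0.
apply: (@leq_trans (d * mdeg a).+1).
  by apply/msize_leP => m /(dhomog_mf (P_homog a)) ->.
by rewrite ltn_mul2l d_gt0.
Qed.

Lemma vanishing_pde_map G : vanishing 1 G -> phi (sigma G) = 0.
Proof. by move=> /(_ [::] 0%MM); rewrite mdeg0 mpolyX0 mul1r; apply. Qed.

End Vanishing.

(** * From f^s to the delta function *)

Lemma frac_reprE (A : idomainType) (u : {fraction A}) :
  u = FracField.tofrac (frac (repr u)).1 / FracField.tofrac (frac (repr u)).2.
Proof.
have nz_d := denom_ratioP (repr u).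
apply: (canRL (mulfK _)); first by rewrite tofrac_eq0.
move: (repr u) (reprK u) nz_d => x <- nz_d; unlock FracField.tofrac.
rewrite -[LHS]FracField.pi_mul; apply/eqmodP; rewrite /= FracField.equivfE.
by rewrite /FracField.mulf !numden_Ratio ?mulf_neq0 ?oner_eq0 //= !mulr1 mulrC.
Qed.

Lemma fracP (A : idomainType) (u : {fraction A}) :
  exists p q, q != 0 /\ u = FracField.tofrac p / FracField.tofrac q.
Proof.
exists (frac (repr u)).1, (frac (repr u)).2.
by split; [exact: denom_ratioP | exact: frac_reprE].
Qed.

(** * Partial derivatives of rational functions *)

Section FracDeriv.
Variables (K : fieldType) (N : nat).
Local Notation Rx := {mpoly K[N]}.
Local Notation Fx := {fraction {mpoly K[N]}}.
Local Notation "p %:F" := (@FracField.tofrac _ p).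
Implicit Types (p q : Rx) (u v : Fx) (j : 'I_N).

(** [frac_deriv] uses the canonical representative; differentiating the cross-multiplied equality
    shows that any other gives the same value. *)
Lemma frac_derivE j p q : q != 0 ->
  frac_deriv j (p%:F / q%:F) = (p^`M(j) * q - p * q^`M(j))%:F / q%:F ^+ 2.
Proof.
move=> nz_q; rewrite /frac_deriv; set u := p%:F / q%:F.
have := frac_reprE u; have := denom_ratioP (repr u).
move: (frac (repr u)).1 (frac (repr u)).2 => p0 q0 nz_q0 /eqP.
rewrite {}/u eqr_div ?tofrac_eq0 // -!tofracM tofrac_eq => /eqP e.
have := congr1 (mderiv j) e; rewrite !mderivM => e'.
apply/eqP; rewrite -!tofracXn eqr_div ?tofrac_eq0 ?expf_neq0 // -!tofracM tofrac_eq.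
rewrite -subr_eq0.
(* The difference is a combination of the equality [e] and its derivative [e']. *)
have -> : (p0^`M(j) * q0 - p0 * q0^`M(j)) * q ^+ 2
   - (p^`M(j) * q - p * q^`M(j)) * q0 ^+ 2 =
   q * q0 * (p0^`M(j) * q + p0 * q^`M(j) - (p^`M(j) * q0 + p * q0^`M(j)))
  - (p0 * q - p * q0) * (q0^`M(j) * q + q0 * q^`M(j)).
  by ring.
by rewrite e' e !subrr mul0r mulr0 subr0.
Qed.

Lemma frac_deriv_tofrac j p : frac_deriv j p%:F = (p^`M(j))%:F.
Proof.
rewrite -[p%:F]divr1 -tofrac1 frac_derivE ?oner_neq0 //.
by rewrite -mpolyC1 mderivC mulr0 subr0 mpolyC1 mulr1 tofrac1 expr1n divr1.
Qed.

Fact frac_deriv_is_additive j : additive (@frac_deriv K N j).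
Proof.
move=> u v; have [p [q [nz_q ->]]] := fracP u; have [p' [q' [nz_q' ->]]] := fracP v.
rewrite -[- (p'%:F / _)]mulNr -tofracN addf_div ?tofrac_eq0 // -!tofracM -tofracD.
rewrite !frac_derivE ?mulf_neq0 // -[- (_%:F / _)]mulNr -tofracN -!tofracXn.
rewrite addf_div ?tofrac_eq0 ?expf_neq0 // -!tofracM -tofracD.
apply/eqP; rewrite eqr_div ?tofrac_eq0 ?mulf_neq0 ?expf_neq0 ?mulf_neq0 //.
by rewrite -!tofracM tofrac_eq mderivD !mderivM !mderivN; apply/eqP; ring.
Qed.
HB.instance Definition _ j :=
  GRing.isAdditive.Build Fx Fx (@frac_deriv K N j) (frac_deriv_is_additive j).

Lemma frac_derivM j u v :
  frac_deriv j (u * v) = frac_deriv j u * v + u * frac_deriv j v.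
Proof.
have [p [q [nz_q ->]]] := fracP u; have [p' [q' [nz_q' ->]]] := fracP v.
rewrite mulf_div -!tofracM !frac_derivE ?mulf_neq0 // -!tofracXn !mulf_div.
rewrite -!tofracM addf_div ?tofrac_eq0 ?mulf_neq0 ?expf_neq0 // -!tofracM -tofracD.
apply/eqP; rewrite eqr_div ?tofrac_eq0 ?mulf_neq0 ?expf_neq0 ?mulf_neq0 //.
by rewrite -!tofracM tofrac_eq !mderivM; apply/eqP; ring.
Qed.

End FracDeriv.

(** * The isomorphism onto the direct image *)

Section IteratedEuler.
Variables (A : comNzRingType) (r : nat) (c : 'I_r -> A).

Definition s_act_seq (m : 'X_{1..r}) (s : seq 'I_r) : {mpoly A[r]} :=
  foldr (fun k => iter (m k) (s_act c k)) 1 s.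

Lemma s_act_seq_eq (m m' : 'X_{1..r}) s :
  {in s, m =1 m'} -> s_act_seq m s = s_act_seq m' s.
Proof.
elim: s => //= k s IHs eq_m; rewrite eq_m ?mem_head // IHs // => l l_s.
by rewrite eq_m // inE l_s orbT.
Qed.

Lemma s_act_iterC k l i G :
  iter i (s_act c l) (s_act c k G) = s_act c k (iter i (s_act c l) G).
Proof. by elim: i => //= i ->; rewrite s_actC. Qed.

(** The s_k commute, so the extra factor can be pulled to the front; as s is duplicate free, only
    one block of iterates changes. *)
Lemma s_act_seqS k m s : uniq s -> k \in s ->
  s_act_seq (m + U_(k))%MM s = s_act c k (s_act_seq m s).
Proof.
elim: s => //= l s IHs /andP [l_s uniq_s]; rewrite inE mnmDE mnm1E.
have [->|nkl] := eqVneq k l => /= k_s.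
  rewrite addn1 iterS; congr (s_act c l (iter _ _ _)); apply: s_act_seq_eq => j j_s.
  rewrite mnmDE mnm1E; case: eqP => [eq_lj|]; last by rewrite addn0.
  by rewrite eq_lj j_s in l_s.
by rewrite addn0 IHs // s_act_iterC.
Qed.

End IteratedEuler.

(* The isomorphism from the rank one module generated by f^s to the direct image
   of K(x) along the graph of f which sends f^s to the delta function; it is
   linear over K(x) and intertwines s_k with - d/dt_k t_k. *)
HB.lock Definition direct_image (A : comNzRingType) r (c : 'I_r -> A)
  (Y : {mpoly A[r]}) : {mpoly A[r]} :=
  \sum_(m <- msupp Y) Y@_m *: s_act_seq c m (enum 'I_r).

Section DirectImage.
Variables (A : comNzRingType) (r : nat) (c : 'I_r -> A).
Local Notation Xi := (direct_image c).

Let F (m : 'X_{1..r}) (a : A) := a *: s_act_seq c m (enum 'I_r).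
Let FD m : {morph F m : x y / x + y}.
Proof. by move=> x y; rewrite /F scalerDl. Qed.

Lemma direct_imageD : {morph Xi : Y Z / Y + Z}.
Proof. by rewrite direct_image.unlock; exact: (mlinD FD). Qed.

Lemma direct_image_sum I (s : seq I) (Q : pred I) Y :
  Xi (\sum_(i <- s | Q i) Y i) = \sum_(i <- s | Q i) Xi (Y i).
Proof. by rewrite direct_image.unlock; exact: (mlin_sum FD). Qed.

Lemma direct_imageZX a m : Xi (a *: 'X_[m]) = a *: s_act_seq c m (enum 'I_r).
Proof. by rewrite direct_image.unlock; exact: (mlinZX FD). Qed.

Lemma direct_imageZ a Y : Xi (a *: Y) = a *: Xi Y.
Proof.
elim/mpolyind: Y => [|b m Y _ _ IH].
  by rewrite scaler0 -(scale0r 'X_[0]) direct_imageZX scale0r scaler0.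
by rewrite scalerDr !direct_imageD IH scalerA !direct_imageZX scalerDr scalerA.
Qed.

Lemma direct_imageC a : Xi a%:MP = a%:MP.
Proof.
rewrite -[a%:MP]mulr1 mul_mpolyC -mpolyX0 direct_imageZX; congr (_ *: _).
by rewrite mpolyX0 /s_act_seq; elim: (enum _) => //= k s ->; rewrite mnm0E.
Qed.

Lemma direct_imageX k Y : Xi ('X_k * Y) = s_act c k (Xi Y).
Proof.
elim/mpolyind: Y => [|a m Y _ _ IH].
  by rewrite mulr0 -mpolyC0 direct_imageC mpolyC0 linear0.
rewrite mulrDr !direct_imageD IH linearD; congr (_ + _).
rewrite -scalerAr -mpolyXD !direct_imageZX linearZ addmC; congr (_ *: _).
by rewrite s_act_seqS ?enum_uniq ?mem_enum.
Qed.

End DirectImage.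

Section FieldDirectImage.
Variables (F : fieldType) (r : nat) (c : 'I_r -> F).
Hypothesis nz_c : forall k, c k != 0.
Local Notation Xi := (direct_image c).

Lemma s_act1 k : s_act c k 1 = - (c k *: 'X_k).
Proof.
by rewrite -mpolyX0 -[X in s_act c k X]scale1r s_actZX mnm0E scale0r sub0r mul1r add0m.
Qed.

(** The claim reduces to delta, where D delta is minus the sum of D(c_k) ∂_(t_k) delta while s_k
    delta = - c_k ∂_(t_k) delta; dividing by c_k matches the two. *)
Lemma direct_image_der (D : {additive F -> F}) :
    (forall x y, D (x * y) = D x * y + x * D y) -> forall Y,
  Xi (map_mpoly D Y + Y * \sum_k (D (c k) / c k)%:MP * 'X_k) = nabla c D (Xi Y).
Proof.
move=> DM; elim/mpoly_ind_mulX=> [Y Z IHY IHZ|a|l Y IH].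
- by rewrite raddfD /= mulrDl addrACA !direct_imageD nablaD -IHY -IHZ !direct_imageD.
- rewrite map_mpolyC direct_imageD !direct_imageC nablaC; congr (_ + _).
  rewrite mul_mpolyC direct_imageZ direct_image_sum scaler_sumr -sumrN.
  apply: eq_bigr => k _; rewrite mul_mpolyC direct_imageZ -['X_k]mulr1.
  rewrite direct_imageX -mpolyC1 direct_imageC mpolyC1 s_act1 mulr1 !scalerN !scalerA.
  by rewrite -mulrA divfK.
by rewrite map_mpoly_derX // -mulrA -mulrDr !direct_imageX IH s_act_nabla.
Qed.

Lemma s_actXn k l H : H^`M(k) = 0 ->
  s_act c k ('X_k ^+ l * H) = l%:R *: ('X_k ^+ l * H) - c k *: ('X_k ^+ l.+1 * H).
Proof.
move=> dH; elim: l => [|l IHl].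
  rewrite !expr0 scale0r sub0r !mul1r expr1 s_act.unlock t_act.unlock dH subr0.
  by rewrite scalerAr.
rewrite exprS -mulrA s_actX IHl eqxx scale1r mulrBr -!scalerAr addrAC.
by rewrite -[X in _ + X - _]scale1r -scalerDl -natr1 !mulrA -!exprS.
Qed.

(** By [s_actXn], s_k - l sends ∂_(t_k)^l to - c_k ∂_(t_k)^(l+1). This converts the binomials in the
    Bernstein-Sato relation into derivatives of delta. *)
Lemma direct_image_falling k l Y : (Xi Y)^`M(k) = 0 ->
  Xi (\prod_(i < l) ('X_k - i%:R) * Y) = (- c k) ^+ l *: ('X_k ^+ l * Xi Y).
Proof.
move=> dY; elim: l => [|l IHl]; first by rewrite big_ord0 !expr0 scale1r !mul1r.
rewrite big_ord_recr /= mulrAC mulrC.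
have -> Z : ('X_k - l%:R) * Z = 'X_k * Z + (- l%:R) *: Z :> {mpoly F[r]}.
  by rewrite mulrBl scaleNr scaler_nat mulr_natl.
rewrite direct_imageD direct_imageX direct_imageZ IHl linearZ /= s_actXn //.
rewrite scalerBr !scalerA mulNr scaleNr mulrC addrAC subrr add0r.
by rewrite [in RHS]exprSr mulrN scaleNr.
Qed.

Lemma mderiv_prod_notin k (s : seq 'I_r) (Q : pred 'I_r) (a : 'I_r -> F)
    (e : 'I_r -> nat) :
  k \notin s ->
  (\prod_(l <- s | Q l) (a l *: 'X_l ^+ e l) : {mpoly F[r]})^`M(k) = 0.
Proof.
move=> k_s; rewrite big_seq_cond; elim/big_ind: _ => [|x y dx dy|j /andP [j_s _]].
- by rewrite -mpolyC1 mderivC.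
- by rewrite mderivM dx dy mul0r mulr0 addr0.
rewrite mderivZ mpolyXn mderivX mulmnE mnm1E.
by rewrite (negbTE (memPn k_s _ j_s)) mul0n scale0r scaler0.
Qed.

Lemma direct_image_prod_falling (s : seq 'I_r) (Q : pred 'I_r) (a : 'I_r -> F)
    (e : 'I_r -> nat) :
  uniq s ->
  Xi (\prod_(k <- s | Q k) (a k *: \prod_(i < e k) ('X_k - i%:R))) =
  \prod_(k <- s | Q k) ((a k * (- c k) ^+ e k) *: 'X_k ^+ e k).
Proof.
elim: s => [|k s IHs] /=; first by rewrite !big_nil -mpolyC1 direct_imageC.
case/andP=> k_s /IHs {}IHs; rewrite !big_cons; case: (Q k) => //.
rewrite -scalerAl direct_imageZ direct_image_falling ?IHs ?mderiv_prod_notin //.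
by rewrite scalerA -scalerAl.
Qed.

End FieldDirectImage.

Section MapGraphOperators.
Variables (A B : comNzRingType) (iota : {rmorphism A -> B}) (r : nat).
Variable (c : 'I_r -> A).

Lemma map_mpoly_mderiv k (G : {mpoly A[r]}) :
  map_mpoly iota G^`M(k) = (map_mpoly iota G)^`M(k).
Proof.
by apply/mpolyP => m; rewrite mcoeff_map_mpoly !mcoeff_deriv mcoeff_map_mpoly raddfMn.
Qed.

Lemma map_s_act k (G : {mpoly A[r]}) :
  map_mpoly iota (s_act c k G) = s_act (iota \o c) k (map_mpoly iota G).
Proof.
rewrite !s_act.unlock !t_act.unlock rmorphN rmorphM rmorphB /= map_mpolyX.
by rewrite map_mpolyZ map_mpoly_mderiv.
Qed.

Lemma map_nabla (D : {additive A -> A}) (D' : {additive B -> B}) (G : {mpoly A[r]}) :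
    (forall a, D' (iota a) = iota (D a)) ->
  map_mpoly iota (nabla c D G) = nabla (iota \o c) D' (map_mpoly iota G).
Proof.
move=> DD'; rewrite !nabla.unlock rmorphB rmorphM /=; congr (_ - _ * _).
  apply/mpolyP => m; rewrite !mcoeff_map_mpoly.
  by rewrite DD'.
by rewrite rmorph_sum; apply: eq_bigr => k _; rewrite /= map_mpolyZ map_mpolyX DD'.
Qed.

Lemma map_mpoly_inj : injective iota -> injective (@map_mpoly r A B iota).
Proof.
move=> inj_iota G H eqGH; apply/mpolyP => m; apply: inj_iota.
by rewrite -!mcoeff_map_mpoly eqGH.
Qed.

End MapGraphOperators.

(** * Roots of Bernstein-Sato relations *)

Section BernsteinSatoRoot.
Variables (K : fieldType) (N r r' d : nat).
Local Notation Rx := {mpoly K[N]}.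
Local Notation Fx := {fraction {mpoly K[N]}}.
Local Notation "p %:F" := (@FracField.tofrac _ p).
Variables (f : 'I_r -> Rx) (P : 'X_{1..r} -> Rx).
Hypothesis f_homog : forall k, f k \is d.-homog.
Hypothesis P_homog : forall a, P a \is (d * mdeg a).-homog.
Hypothesis P_pde : forall (i : 'I_N) a,
  'X_i * P a = \sum_k diff_op (f k)^`M(i) (P (a + U_(k))%MM).
Hypothesis d_gt0 : (0 < d)%N.
Variables (g : 'I_r' -> Rx) (cc : 'I_r -> 'I_r' -> Rx) (aa : 'I_r' -> 'I_r -> Rx).
Hypothesis f_g : forall k, f k = \sum_l cc k l * g l.
Hypothesis g_f : forall l, g l = \sum_k aa l k * f k.
Hypothesis nz_g : forall l, g l != 0.

Let gF : 'I_r' -> Fx := fun l => (g l)%:F.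
Let nz_gF l : gF l != 0.
Proof. by rewrite tofrac_eq0. Qed.

Local Notation Xi := (direct_image gF).
Local Notation iota := (map_mpoly (@FracField.tofrac Rx)).
Local Notation vanishing := (vanishing P g cc).

(** The direct image of Y has coefficients in K(x); it is required to come from K[x], where
    [vanishing] and [pde_map] are defined. *)
Definition fs_vanishing j (Y : fs_module K N r') : Prop :=
  exists2 G, Xi Y = iota G & vanishing j G.

Lemma fs_vanishingD j Y Z : fs_vanishing j Y -> fs_vanishing j Z ->
  fs_vanishing j (Y + Z).
Proof.
move=> [G eG vG] [H eH vH]; exists (G + H); last exact: vanishingD.
by rewrite direct_imageD eG eH rmorphD.
Qed.

Lemma fs_vanishing0 j : fs_vanishing j 0.
Proof.
exists 0; last exact: vanishing0.
by rewrite -mpolyC0 direct_imageC mpolyC0 rmorph0.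
Qed.

Lemma fs_vanishing_sum j I (s : seq I) (Q : pred I) Y :
  (forall i, Q i -> fs_vanishing j (Y i)) ->
  fs_vanishing j (\sum_(i <- s | Q i) Y i).
Proof.
move=> vY; elim/big_ind: _ => [|Y1 Y2|i Qi].
- exact: fs_vanishing0.
- exact: fs_vanishingD.
- exact: vY.
Qed.

Lemma fs_vanishing_coef j (p : {mpoly Rx[r']}) Y :
  fs_vanishing j Y -> fs_vanishing j (iota p * Y).
Proof.
move=> vY; elim/mpoly_ind_mulX: p => [p q vp vq|h|k p [G eG vG]].
- by rewrite (raddfD iota) mulrDl; exact: fs_vanishingD vp vq.
- have [G eG vG] := vY; exists (h *: G); last exact: vanishingZ.
  by rewrite map_mpolyC mul_mpolyC direct_imageZ eG map_mpolyZ.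
exists (s_act g k G); last exact: vanishing_s_act.
by rewrite rmorphM /= map_mpolyX -mulrA direct_imageX eG map_s_act.
Qed.

Lemma fs_vanishing_deriv j i Y :
  fs_vanishing j Y -> fs_vanishing j (fs_deriv g i Y).
Proof.
move=> [G eG vG]; exists (nabla g (mderiv i) G).
  have -> : iota (nabla g (mderiv i) G) = nabla gF (@frac_deriv K N i) (iota G).
    by apply: map_nabla => a; exact: frac_deriv_tofrac.
  rewrite -eG -(direct_image_der nz_gF); last exact: frac_derivM.
  congr (Xi (_ + _ * _)); apply: eq_bigr => k _.
  by rewrite /= frac_deriv_tofrac.
exact: (vanishing_nabla P_pde f_g).
Qed.

Lemma fs_vanishing_derivm j beta Y :
  fs_vanishing j Y -> fs_vanishing j (fs_derivm g beta Y).
Proof.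
move=> vY; rewrite /fs_derivm; elim: (enum _) => //= i s vs.
by elim: (beta i) => //= e ve; apply: fs_vanishing_deriv.
Qed.

Lemma fs_vanishing_weyl j (W : weyl K N r') Y :
  fs_vanishing j Y -> fs_vanishing j (weyl_act g W Y).
Proof.
move=> vY; apply: fs_vanishing_sum => beta _.
exact/fs_vanishing_coef/fs_vanishing_derivm.
Qed.

(** On constants t_k is multiplication by g_k, so each factor raises the order of delta by one. *)
Lemma vanishing_prod_g (s : seq 'I_r') (Q : pred 'I_r') (e : 'I_r' -> nat) :
  vanishing (\sum_(k <- s | Q k) e k) (\prod_(k <- s | Q k) g k ^+ e k)%:MP.
Proof.
elim: s => [|k s IHs].
  rewrite !big_nil mpolyC1.
  exact: (vanishing1 f_homog P_homog _ g_f d_gt0).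
rewrite !big_cons; case: (Q k) => //.
elim: (e k) => [|i IHi]; first by rewrite expr0 mul1r.
rewrite exprS -mulrA addSn.
have -> : (g k * (g k ^+ i * \prod_(l <- s | Q l) g l ^+ e l))%:MP =
    t_act g k (g k ^+ i * \prod_(l <- s | Q l) g l ^+ e l)%:MP.
  by rewrite t_act.unlock mderivC subr0 -mul_mpolyC mpolyCM.
exact: vanishing_t_act.
Qed.

Lemma vanishing_prodX j (s : seq 'I_r') (Q : pred 'I_r') (e : 'I_r' -> nat) G :
  vanishing (j + \sum_(k <- s | Q k) e k) G ->
  vanishing j (\prod_(k <- s | Q k) 'X_k ^+ e k * G).
Proof.
elim: s j => [|k s IHs] j; first by rewrite !big_nil addn0 mul1r.
rewrite !big_cons; case: (Q k) => [vG|]; last exact: IHs.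
rewrite -mulrA; elim: (e k) j vG => [|i IHi] j vG.
  by rewrite expr0 mul1r; apply: IHs; rewrite add0n in vG.
rewrite exprS -mulrA; apply: vanishing_mulX; apply: IHi.
by rewrite !addSn addnS in vG *.
Qed.

(** For u_k < 0 the binomial supplies the power of g_k that cancels the pole and leaves
    ∂_(t_k)^(-u_k); for u_k >= 0 the factor is t_k^(u_k). The resulting order is the sum of the
    u_k. *)
Lemma fs_vanishing_shift (u : {ffun 'I_r' -> int}) :
  \sum_k u k = 1 -> fs_vanishing 1 (fs_shift g u).
Proof.
move=> sum_u; pose e k := `|u k|%N; pose Q k := u k < 0.
(* The factorial comes from the binomial and the sign from (- g_k)^e; the powers of g_k cancel. *)
pose a k : K := (-1) ^+ e k / (e k)`!%:R.
pose G := (\prod_(k | Q k) 'X_k ^+ e k) * (\prod_(k | ~~ Q k) g k ^+ e k)%:MP.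
have sum_e : (\sum_(k | ~~ Q k) e k = 1 + \sum_(k | Q k) e k)%N.
  have posz_sum (R : pred 'I_r') :
      (\sum_(k | R k) e k)%N = \sum_(k | R k) Posz (e k) :> int.
    exact: (big_morph Posz PoszD).
  suff: \sum_k u k = Posz (\sum_(k | ~~ Q k) e k)%N - Posz (\sum_(k | Q k) e k)%N.
    by rewrite sum_u; lia.
  rewrite (bigID Q) /= addrC !posz_sum -sumrN; congr (_ + _); apply: eq_bigr => k.
    by rewrite /Q -leNgt => uk; rewrite /e gez0_abs.
  by move=> uk; rewrite /e ltz0_abs ?opprK.
exists ((\prod_(k | Q k) a k)%:MP *: G); last first.
  apply: vanishingZ; apply: vanishing_prodX; rewrite -sum_e.
  exact: vanishing_prod_g.
rewrite /fs_shift mulrC mul_mpolyC direct_imageZ.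
have -> : Xi (\prod_(k | Q k) s_binom K N k (e k)) =
    \prod_(k | Q k) (((e k)`!%:R^-1 * (- gF k) ^+ e k) *: 'X_k ^+ e k).
  exact/direct_image_prod_falling/index_enum_uniq.
rewrite scaler_prod scalerA map_mpolyZ rmorphM /= map_mpolyC.
have -> : iota (\prod_(k | Q k) 'X_k ^+ e k) = \prod_(k | Q k) 'X_k ^+ e k.
  by rewrite rmorph_prod; apply: eq_bigr => k _; rewrite rmorphXn /= map_mpolyX.
rewrite [_ * _%:MP]mulrC mul_mpolyC scalerA; congr (_ *: _).
rewrite (bigID Q) /= mulrAC -big_split /= !rmorph_prod /=; congr (_ * _).
  apply: eq_bigr => k uk; rewrite /a.
  have -> : u k = - Posz (e k) by rewrite /e ltz0_abs ?opprK.
  pose h : {rmorphism K -> Fx} := @FracField.tofrac Rx \o @mpolyC N K.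
  rewrite -exprnN -[RHS]/(h _) fmorph_div rmorph_nat rmorphXn rmorphN1.
  rewrite [in LHS]exprNn mulrCA [_ * (_ * gF k ^+ _)]mulrCA mulVf ?expf_neq0 ?nz_gF //.
  by rewrite mulr1 mulrC.
apply: eq_bigr => k; rewrite -leNgt => uk; rewrite rmorphXn /=.
by rewrite exprnP /e gez0_abs.
Qed.

Lemma bernstein_sato_rel_root n b : (d%:R != 0 :> K) -> N = (d * n)%N ->
  P 0%MM != 0 -> bernstein_sato_rel g b -> b.[- n%:R] = 0.
Proof.
move=> nz_d eN nz_P [us [W [sum_us eq_b]]].
have [G eG vG] : fs_vanishing 1 (fs_eval N r' b).
  rewrite eq_b big_seq; apply: fs_vanishing_sum => u /sum_us sum_u.
  exact/fs_vanishing_weyl/fs_vanishing_shift.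
pose S (H : {mpoly Rx[r']}) := \sum_k s_act g k H.
have eval_b : fs_eval N r' b =
  \sum_(i < size b) ((b`_i)%:MP%:F)%:MP * (\sum_(k < r') 'X_k) ^+ i.
  pose h : {rmorphism K -> fs_module K N r'} :=
    @mpolyC r' _ \o (@FracField.tofrac Rx \o @mpolyC N K).
  have -> : fs_eval N r' b = (map_poly h b).[\sum_(k < r') 'X_k] by [].
  rewrite horner_coef (size_map_poly h); apply: eq_bigr => i _.
  by rewrite (coef_map h).
have XiS H Y : Xi Y = iota H -> Xi ((\sum_(k < r') 'X_k) * Y) = iota (S H).
  move=> eY; rewrite mulr_suml direct_image_sum rmorph_sum /=.
  by apply: eq_bigr => k _; rewrite direct_imageX eY map_s_act.
(* The identity is checked over K(x), into which K[x] embeds. *)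
have eG' : G = \sum_(i < size b) (b`_i)%:MP *: iter i S 1.
  apply: (@map_mpoly_inj _ _ (@FracField.tofrac Rx)).
    by move=> p q /eqP; rewrite tofrac_eq => /eqP.
  rewrite -eG eval_b direct_image_sum rmorph_sum /=; apply: eq_bigr => i _.
  rewrite mul_mpolyC direct_imageZ map_mpolyZ; congr (_ *: _).
  elim: (i : nat) => [|e IHe] /=.
    rewrite expr0 -[X in Xi X]mpolyC1 direct_imageC.
    by rewrite -(mpolyC1 r' Rx) map_mpolyC /= rmorph1.
  rewrite exprS.
  exact: XiS IHe.
have phiS H : pde_map P (change_family cc (S H)) =
    - n%:R *: pde_map P (change_family cc H).
  rewrite (change_family_s_act f_g); apply: (scalerI nz_d).
  rewrite (pde_map_s_act f_homog P_homog P_pde) scalerA mulrN -natrM -eN.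
  by [].
(* The image of b(s) delta is 0 because its order is at least one, and equals b(- n) P_0 because s_1
   + ... + s_r' acts as - n. *)
have := vanishing_pde_map vG; rewrite eG' linear_sum pde_map_sum /=.
have phi_iter i : pde_map P (change_family cc (iter i S 1)) = (- n%:R) ^+ i *: P 0%MM.
  elim: i => [|i IHi] /=; last by rewrite phiS IHi scalerA -exprS.
  rewrite -mpolyC1 change_familyC mpolyC1 -mpolyX0 -[X in pde_map P X]scale1r.
  by rewrite pde_mapZX diff_op1 expr0 scale1r.
under eq_bigr do rewrite linearZ /= pde_mapZ phi_iter diff_opC scalerA.
rewrite -scaler_suml => /eqP; rewrite scaler_eq0 (negbTE nz_P) orbF => /eqP.
by rewrite horner_coef.
Qed.

End BernsteinSatoRoot.

(** * Maximal minors *)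

Section Capelli.
Variables (K : fieldType) (m n : nat).
Local Notation Rx := {mpoly K[m * n]}.
Implicit Types (q : Rx).

Local Notation x i j := ('X_(mxvec_index i j) : Rx).

(** Repeated columns are allowed, so that Capelli sums can run over all maps lam; their determinants
    vanish. *)
Definition minor_mx p (rho : 'I_p -> 'I_m) (lam : 'I_p -> 'I_n) : 'M[Rx]_p :=
  \matrix_(a, b) x (rho a) (lam b).

Lemma mderiv_x i j i' j' :
  (x i j)^`M(mxvec_index i' j') = ((i == i') && (j == j'))%:R.
Proof.
rewrite mderivXU; congr (nat_of_bool _)%:R.
apply/eqP/andP => [eq_ij|[/eqP-> /eqP->]//].
have [h hK _] := curry_mxvec_bij m n.
have := hK (i, j) isT; rewrite /= eq_ij (hK (i', j') isT).
by case=> -> ->.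
Qed.

Lemma mderiv_sign e k : ((-1) ^+ e : Rx)^`M(k) = 0.
Proof. by rewrite -mpolyC1 -mpolyCN -rmorphXn mderivC. Qed.

Lemma mderiv_prod0 I (s : seq I) (Q : pred I) (F : I -> Rx) k :
  (forall i, Q i -> (F i)^`M(k) = 0) -> (\prod_(i <- s | Q i) F i)^`M(k) = 0.
Proof.
move=> dF; elim/big_ind: _ => [|y z dy dz|]; last exact: dF.
  by rewrite -mpolyC1 mderivC.
by rewrite mderivM dy dz mul0r mulr0 addr0.
Qed.

Lemma mderiv_det_minor0 p (rho : 'I_p -> 'I_m) lam i l :
  (forall a, rho a != i) -> (\det (minor_mx rho lam))^`M(mxvec_index i l) = 0.
Proof.
move=> rho_i; rewrite /determinant linear_sum big1 // => s _ /=.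
rewrite mderivM mderiv_prod0 ?mulr0 ?addr0 => [|a _].
  by rewrite mderiv_sign mul0r.
by rewrite mxE mderiv_x (negbTE (rho_i a)).
Qed.

Lemma cofactor_minor p (rho : 'I_p -> 'I_m) (lam : 'I_p -> 'I_n) a b :
  cofactor (minor_mx rho lam) a b =
  (-1) ^+ (a + b) * \det (minor_mx (rho \o lift a) (lam \o lift b)).
Proof.
by congr (_ * \det _); apply/matrixP=> i j; rewrite !mxE.
Qed.

(** Injectivity of rho confines these variables to row a of the matrix; column l may occur several
    times in lam, whence the sum over b. *)
Lemma mderiv_det_minor p (rho : 'I_p -> 'I_m) lam a l : injective rho ->
  (\det (minor_mx rho lam))^`M(mxvec_index (rho a) l) =
  \sum_b (lam b == l)%:R * cofactor (minor_mx rho lam) a b.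
Proof.
move=> rho_inj; rewrite (expand_det_row _ a) linear_sum; apply: eq_bigr => b _ /=.
rewrite mderivM mxE mderiv_x eqxx /= cofactor_minor.
rewrite [X in _ + _ * X](_ : _ = 0) ?mulr0 ?addr0 //.
rewrite mderivM mderiv_det_minor0 ?mulr0 ?addr0 => [|c].
  by rewrite mderiv_sign mul0r.
by rewrite /= (inj_eq rho_inj) eq_sym neq_lift.
Qed.


Definition extend_at p (a : 'I_p.+1) (l : 'I_n) (lam : 'I_p -> 'I_n) b :=
  if unlift a b is Some b' then lam b' else l.

Lemma extend_at_lift p (a : 'I_p.+1) l lam b : extend_at a l lam (lift a b) = lam b.
Proof. by rewrite /extend_at liftK. Qed.

Lemma extend_at_id p (a : 'I_p.+1) l lam : extend_at a l lam a = l.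
Proof. by rewrite /extend_at unlift_none. Qed.

Lemma eq_minor_mx p (rho rho' : 'I_p -> 'I_m) (lam lam' : 'I_p -> 'I_n) :
  rho =1 rho' -> lam =1 lam' -> minor_mx rho lam = minor_mx rho' lam'.
Proof. by move=> eq_rho eq_lam; apply/matrixP => a b; rewrite !mxE eq_rho eq_lam. Qed.

Lemma cofactor_minor_extend p (rho : 'I_p.+1 -> 'I_m) a l lam :
  cofactor (minor_mx rho (extend_at a l lam)) a a =
  \det (minor_mx (rho \o lift a) lam).
Proof.
rewrite cofactor_minor addnn -signr_odd odd_double mul1r.
by rewrite (eq_minor_mx (fun=> erefl) (extend_at_lift _ _ _)).
Qed.

(* The matrix obtained by putting e_a + e_b in row a has two equal columns. *)
Lemma cofactor_minor_extend_lift p (rho : 'I_p.+1 -> 'I_m) a b lam :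
  cofactor (minor_mx rho (extend_at a (lam b) lam)) a (lift a b) =
  - \det (minor_mx (rho \o lift a) lam).
Proof.
set M := minor_mx _ _; rewrite -(cofactor_minor_extend rho a (lam b)) -/M.
pose M' : 'M[Rx]_p.+1 := \matrix_(i, j)
  if i == a then ((j == a) || (j == lift a b))%:R else M i j.
have cof_eq j : cofactor M' a j = cofactor M a j.
  congr (_ * \det _); apply/matrixP=> i k; rewrite !mxE.
  by rewrite eq_sym (negbTE (neq_lift _ _)).
apply/eqP; rewrite -addr_eq0 addrC -!cof_eq; apply/eqP.
have : \det M' = 0.
  rewrite -det_tr; apply: (@determinant_alternate _ _ _ a (lift a b)).
    exact: neq_lift.
  move=> i; rewrite !mxE !eqxx orbT; case: eqP => // _.
  by rewrite extend_at_id extend_at_lift.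
have M'a j : M' a j = ((j == a) || (j == lift a b))%:R by rewrite mxE eqxx.
rewrite (expand_det_row _ a); move: (cofactor M' a) => cf.
under eq_bigr do rewrite M'a; rewrite (bigD1 a) // (bigD1 (lift a b)) /=; last first.
  by rewrite eq_sym neq_lift.
rewrite !eqxx orbT !mul1r big1 ?addr0 // => j /andP [/negbTE ja /negbTE jb].
by rewrite ja jb mul0r.
Qed.

(* q transforms by the k-th power of the determinant under the polarizations
   \sum_l x c l * d/dx_(a,l). *)
Definition polar_eigen k q := forall c a,
  \sum_l x c l * q^`M(mxvec_index a l) = ((c == a) * k)%:R *: q.

Lemma polar_eigen1 : polar_eigen 0 1.
Proof.
move=> c a; rewrite muln0 scale0r big1 // => l _.
by rewrite -mpolyC1 mderivC mulr0.
Qed.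

Lemma polar_eigenM k k' q q' :
  polar_eigen k q -> polar_eigen k' q' -> polar_eigen (k + k') (q * q').
Proof.
move=> eq_q eq_q' c a; under eq_bigr do rewrite mderivM mulrDr.
rewrite big_split /=; under eq_bigr do rewrite mulrA.
under [X in _ + X]eq_bigr do rewrite mulrCA.
rewrite -mulr_suml -mulr_sumr eq_q eq_q' mulnDr natrD scalerDl.
by rewrite scalerAl scalerAr.
Qed.

(** Polarization replaces row a by row c, which gives the (c, a) entry of M adj(M) = det(M) I. *)
Lemma polar_eigen_det (lam : 'I_m -> 'I_n) :
  polar_eigen 1 (\det (minor_mx id lam)).
Proof.
move=> c a; under eq_bigr do
  rewrite (mderiv_det_minor lam a _ (@inj_id _)) mulr_sumr.
rewrite exchange_big /=.
transitivity ((minor_mx id lam *m \adj (minor_mx id lam)) c a).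
  rewrite mxE; apply: eq_bigr => b _; rewrite (bigD1 (lam b)) //= big1 ?addr0.
    by rewrite !mxE eqxx mul1r.
  by move=> l nl; rewrite eq_sym (negbTE nl) mul0r mulr0.
by rewrite mul_mx_adj mxE muln1 scaler_nat.
Qed.

(** Differentiating the minor gives d for each of the n values of l, through the inserted column,
    and - d for each of the p columns of lam, when l equals it. When q is differentiated instead,
    expanding along the inserted column and [polar_eigen] leave k d q. *)
Lemma capelli_step p (rho : 'I_p.+1 -> 'I_m) a (lam : 'I_p -> 'I_n) k q :
    injective rho -> polar_eigen k q ->
  \sum_l (\det (minor_mx rho (extend_at a l lam)) * q)^`M(mxvec_index (rho a) l) =
  (n%:R - p%:R + k%:R) *: (\det (minor_mx (rho \o lift a) lam) * q).
Proof.
move=> rho_inj eig_q; under eq_bigr do rewrite mderivM.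
rewrite big_split /= -mulr_suml.
set d := \det (minor_mx (rho \o lift a) lam).
have -> : \sum_l (\det (minor_mx rho (extend_at a l lam)))^`M(mxvec_index (rho a) l)
    = (n%:R - p%:R) *: d.
  under eq_bigr => l _ do
    rewrite mderiv_det_minor // (bigD1_ord a) //= extend_at_id eqxx mul1r
      cofactor_minor_extend -/d.
  rewrite big_split sumr_const card_ord /= exchange_big /=.
  under [X in _ + X]eq_bigr => b _.
    rewrite (bigD1 (lam b)) //= big1 ?addr0 => [|l nl].
      rewrite extend_at_lift eqxx mul1r cofactor_minor_extend_lift -/d. over.
    by rewrite extend_at_lift eq_sym (negbTE nl) mul0r.
  by rewrite sumr_const card_ord scalerBl !scaler_nat mulNrn.
have -> : \sum_l \det (minor_mx rho (extend_at a l lam)) * q^`M(mxvec_index (rho a) l)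
    = k%:R *: (d * q).
  pose cof (b : 'I_p.+1) := (-1) ^+ (b + a) * \det (minor_mx (rho \o lift b) lam).
  transitivity (\sum_b cof b *
      \sum_l x (rho b) l * q^`M(mxvec_index (rho a) l)).
    under [RHS]eq_bigr do rewrite mulr_sumr.
    rewrite exchange_big; apply: eq_bigr => l _ /=.
    rewrite (expand_det_col _ a) mulr_suml; apply: eq_bigr => b _.
    rewrite mxE extend_at_id cofactor_minor -mulrA mulrCA.
    by rewrite (eq_minor_mx (fun=> erefl) (extend_at_lift _ _ _)).
  under eq_bigr do rewrite eig_q (inj_eq rho_inj).
  rewrite (bigD1 a) //= big1 ?addr0 => [|b /negbTE ->].
    by rewrite eqxx mul1n /cof addnn -signr_odd odd_double mul1r scalerAr.
  by rewrite scale0r mulr0.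
by rewrite -scalerAl -scalerDl.
Qed.

(** The rows other than i are eliminated one at a time; going from size t + 2 to t + 1 costs the
    factor n - (t + 1) + k. *)
Lemma capelli p (rho : 'I_p.+1 -> 'I_m) i j k q :
    injective rho -> polar_eigen k q ->
  \sum_(lam : {ffun 'I_p.+1 -> 'I_n} | lam i == j)
    (\det (minor_mx rho lam) * q)^`M[\sum_(a | a != i) U_(mxvec_index (rho a) (lam a))] =
  (\prod_(t < p) (n%:R - t.+1%:R + k%:R)) *: (x (rho i) j * q).
Proof.
move=> rho_inj eig_q; elim: p rho rho_inj i => [|p IHp] rho rho_inj i.
  rewrite big_ord0 scale1r (big_pred1 [ffun=> j]) => [|lam].
    by rewrite big_pred0 => [|a]; rewrite ?mderivm0m ?det_mx11 ?mxE ?ffunE ?ord1.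
  apply/eqP/eqP=> [lam_i|->]; last by rewrite ffunE.
  by apply/ffunP=> a; rewrite ffunE -lam_i !ord1.
(* A row a other than i to eliminate: the first one, or the last one if i is the first. *)
have [a [i' ->]] : exists a i', i = lift a i'.
  have [<-|/unlift_some [i' -> _]] := eqVneq ord0 i; last by exists ord0, i'.
  by exists ord_max, ord0; apply: val_inj.
(* Split lam into its value at a, the summation index of [capelli_step], and its restriction to the
   other positions. *)
pose h (y : 'I_n * {ffun 'I_p.+1 -> 'I_n}) : {ffun 'I_p.+2 -> 'I_n} :=
  [ffun b => extend_at a y.1 y.2 b].
pose h' (lam : {ffun 'I_p.+2 -> 'I_n}) := (lam a, [ffun b => lam (lift a b)]).
have hK : cancel h h'.
  move=> [l lam]; rewrite /h /h' ffunE extend_at_id; congr (_, _).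
  by apply/ffunP=> b; rewrite !ffunE extend_at_lift.
have h'K : cancel h' h.
  move=> lam; apply/ffunP=> b; rewrite ffunE /extend_at /=.
  by case: unliftP => [b' ->|->]; rewrite ?ffunE.
rewrite (reindex h) /=; last by exists h' => y _; [exact: hK | exact: h'K].
rewrite (eq_bigl (fun y : 'I_n * {ffun 'I_p.+1 -> 'I_n} =>
  predT y.1 && (y.2 i' == j))); last first.
  by move=> [l lam]; rewrite /h ffunE extend_at_lift.
rewrite -(pair_big predT (fun lam : {ffun 'I_p.+1 -> 'I_n} => lam i' == j)
  (fun l lam => (\det (minor_mx rho (h (l, lam))) * q)^`M[
     \sum_(b | b != lift a i') U_(mxvec_index (rho b) (h (l, lam) b))])) /=.
rewrite exchange_big big_ord_recr /= mulrC -scalerA.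
have := IHp (rho \o lift a) (inj_comp rho_inj lift_inj) i'.
rewrite /= => <-; rewrite scaler_sumr; apply: eq_bigr => lam _.
rewrite -mderivmZ -(capelli_step a lam rho_inj eig_q) linear_sum.
apply: eq_bigr => l _ /=.
have hE : h (l, lam) =1 extend_at a l lam by move=> b; rewrite ffunE.
rewrite (bigD1_ord a) ?neq_lift //= mderivmDm mderivmU1m hE extend_at_id.
rewrite (eq_minor_mx (fun=> erefl) hE); congr (_^`M[_]).
apply: eq_big => [b|b _]; first by rewrite (inj_eq lift_inj).
by rewrite hE extend_at_lift.
Qed.

Local Notation col_of := (@column_of m n).

Lemma column_of_inj (B : column_set m n) : injective (col_of B).
Proof.
by move=> a b /enum_val_inj /cast_ord_inj.
Qed.

Lemma maximal_minorE (B : column_set m n) :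
  maximal_minor K B = \det (minor_mx id (col_of B)).
Proof. by congr (\det _); apply/matrixP => a b; rewrite !mxE. Qed.

Lemma det_minor_perm (lam : 'I_m -> 'I_n) (s : {perm 'I_m}) :
  \det (minor_mx id (lam \o s)) = (-1) ^+ s * \det (minor_mx id lam).
Proof.
have -> : minor_mx id (lam \o s) = col_perm s (minor_mx id lam).
  by apply/matrixP=> a b; rewrite !mxE.
by rewrite col_permE det_mulmx det_perm odd_permV mulrC.
Qed.

(** Only the minor in the operator is expanded over permutations; each sign is absorbed by permuting
    the columns of the other minor. *)
Lemma diff_op_dminor (lam : 'I_m -> 'I_n) i j q :
  diff_op (\det (minor_mx id lam))^`M(mxvec_index i j) (\det (minor_mx id lam) * q) =
  \sum_(s : {perm 'I_m} | lam (s i) == j)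
    (\det (minor_mx id (lam \o s)) * q)
      ^`M[\sum_(a | a != i) U_(mxvec_index a (lam (s a)))].
Proof.
rewrite {1}/determinant linear_sum diff_op_suml /= [RHS]big_mkcond; apply: eq_bigr => s _.
rewrite det_minor_perm (bigD1 i) //= mderivM mderiv_sign mul0r add0r mderivM.
rewrite mxE mderiv_x eqxx /= mderiv_prod0 ?mulr0 ?addr0 => [|a /negbTE nai]; last first.
  by rewrite mxE mderiv_x nai.
case: eqP => _; last by rewrite mul0r mulr0 diff_op0l.
rewrite mul1r (eq_bigr (fun a => x a (lam (s a)))) => [|a _]; last by rewrite mxE.
have sgnE (p : Rx) : (-1) ^+ s * p = ((-1) ^+ s : K) *: p.
  by rewrite -mul_mpolyC rmorphXn rmorphN1.
by rewrite mprodXE -mulrA !sgnE diff_opZX mderivmZ.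
Qed.

Lemma column_of_image (B : column_set m n) : [set col_of B a | a : 'I_m] = val B.
Proof.
apply/eqP; rewrite eqEcard card_imset; last exact: column_of_inj.
rewrite card_ord (eqP (valP B)) leqnn andbT.
by apply/subsetP=> _ /imsetP [a _ ->]; exact: enum_valP.
Qed.

(** An injective lam determines B as its image and s by comparison with the increasing enumeration
    of B. *)
Lemma sum_column_sets (V : zmodType) (Phi : {ffun 'I_m -> 'I_n} -> V)
    (i : 'I_m) (j : 'I_n) :
    (forall lam : {ffun 'I_m -> 'I_n}, ~~ injectiveb lam -> Phi lam = 0) ->
  \sum_(B : column_set m n) \sum_(s : {perm 'I_m} | col_of B (s i) == j)
    Phi [ffun a => col_of B (s a)] = \sum_(lam : {ffun _ -> _} | lam i == j) Phi lam.
Proof.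
move=> Phi0; pose im (lam : {ffun 'I_m -> 'I_n}) := [set lam a | a : 'I_m].
transitivity (\sum_(lam : {ffun _ -> _} | lam i == j)
  \sum_(B : column_set m n | im lam == val B) Phi lam).
  rewrite [RHS](exchange_big_dep predT) //=; apply: eq_bigr => B _.
  pose h (s : {perm 'I_m}) := [ffun a => col_of B (s a)].
  have h_inj : injective h.
    move=> s s' /ffunP eq_h; apply/permP => a.
    by have := eq_h a; rewrite !ffunE => /column_of_inj.
  rewrite -(big_imset _ (in2W h_inj)) /=; apply: eq_bigl => lam.
  apply/imsetP/andP => [[s s_i ->]|[lam_i /eqP im_lam]].
    split; first by rewrite ffunE; exact: s_i.
    rewrite -column_of_image; apply/eqP/setP => l.
    apply/imsetP/imsetP => [[a _ ->]|[a _ ->]].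
      by exists (s a); rewrite ?ffunE.
    by exists (s^-1%g a); rewrite ?ffunE ?permKV.
  have ex a : exists b, col_of B b == lam a.
    have : lam a \in [set col_of B a | a : 'I_m].
      by rewrite (etrans (column_of_image B) (esym im_lam)); apply: imset_f.
    by case/imsetP=> b _ ->; exists b.
  have lamE a : col_of B (xchoose (ex a)) = lam a by apply/eqP/(xchooseP (ex a)).
  have lam_inj : injective lam.
    have /imset_injP inj : #|[set lam a | a : 'I_m]| == #|'I_m|.
      by rewrite -/(im lam) im_lam card_ord (eqP (valP B)).
    by move=> a b; apply: inj.
  have s_inj : injective (fun a => xchoose (ex a)).
    by move=> a b eq_ab; apply: lam_inj; rewrite -!lamE eq_ab.
  have lam_h : lam = h (perm s_inj) by apply/ffunP=> a; rewrite ffunE permE lamE.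
  exists (perm s_inj) => //.
  by rewrite unfold_in permE lamE.
apply: eq_bigr => lam _; have [lam_inj|/Phi0 ->] := boolP (injectiveb lam); last first.
  by rewrite big1.
have card_im : #|im lam| == m by rewrite card_imset ?card_ord //; exact/injectiveP.
by rewrite (big_pred1 (Sub (im lam) card_im : column_set m n)).
Qed.

End Capelli.

(** * The polynomial PDE for maximal minors and the resulting root *)

Lemma capelli_minors (K : fieldType) p n (i : 'I_p.+1) (j : 'I_n) k q :
    polar_eigen k q ->
  \sum_(B : column_set p.+1 n) diff_op (maximal_minor K B)^`M(mxvec_index i j)
     (maximal_minor K B * q) =
  (\prod_(t < p) (n%:R - t.+1%:R + k%:R)) *: ('X_(mxvec_index i j) * q).
Proof.
move=> eig_q; rewrite -(@capelli _ _ _ p id i j k q (@inj_id _) eig_q).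
pose Phi (lam : {ffun 'I_p.+1 -> 'I_n}) := (\det (minor_mx K id lam) * q)
  ^`M[\sum_(a | a != i) U_(mxvec_index a (lam a))].
rewrite -[RHS](@sum_column_sets _ _ {mpoly K[p.+1 * n]} Phi i j) => [|lam].
  apply: eq_bigr => B _; rewrite maximal_minorE diff_op_dminor; apply: eq_bigr => s _.
  rewrite /Phi; congr (_^`M[_]); first by apply: eq_bigr => a _; rewrite ffunE.
  rewrite (eq_minor_mx K (fun=> erefl) (lam' := column_of B \o s)) // => a.
  by rewrite ffunE.
case/injectivePn => a [b nab eq_lam]; rewrite /Phi.
have -> : \det (minor_mx K id lam) = 0; last by rewrite mul0r linear0.
rewrite -det_tr; apply: (determinant_alternate nab) => c.
by rewrite !mxE eq_lam.
Qed.

Lemma maximal_minor_homog (K : fieldType) m n (B : column_set m n) :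
  maximal_minor K B \is m.-homog.
Proof.
rewrite maximal_minorE rpred_sum // => s _.
rewrite (_ : (-1) ^+ s = (((-1) ^+ s : K)%:MP)) ?mul_mpolyC; last first.
  by rewrite rmorphXn rmorphN1.
apply: dhomogZ; under eq_bigr do rewrite mxE.
rewrite mprodXE dhomogX.
rewrite /= mdeg_sum (eq_bigr (fun=> 1%N)) => [|a _]; last by rewrite mdeg1.
by rewrite sum1_card card_ord.
Qed.

Lemma polar_eigen_prod (K : fieldType) m n (I : finType) (F : I -> {mpoly K[m * n]})
    (alpha : I -> nat) :
  (forall k, polar_eigen 1 (F k)) ->
  polar_eigen (\sum_k alpha k) (\prod_k F k ^+ alpha k).
Proof.
move=> eigF; elim/big_ind2: _ => [|k p k' q|k _].
- exact: polar_eigen1.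
- exact: polar_eigenM.
elim: (alpha k) => [|e IHe]; first exact: polar_eigen1.
by rewrite exprS -addn1 addnC; apply: polar_eigenM.
Qed.

Lemma maximal_minor_pde (K : numFieldType) m n : (0 < m)%N -> (m <= n)%N ->
  polynomial_pde m (@maximal_minor K m n).
Proof.
case: m => // p _ lt_pn; split; first exact: maximal_minor_homog.
pose c k : K := \prod_(t < p) (n%:R - t.+1%:R + k%:R).
have nz_c k : c k != 0.
  apply/prodf_neq0 => t _.
  (* Since t + 1 <= p < n, every factor is a positive integer. *)
  rewrite -natrB ?(leq_trans (ltn_ord t)) ?(ltnW lt_pn) // -natrD pnatr_eq0.
  by have := ltn_ord t; lia.
(* Dividing f^alpha by c_0 ... c_(|alpha| - 1) makes the Capelli scalar c_|alpha| cancel when alpha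
   + e_B is brought back to alpha. *)
pose C k := \prod_(j < k) c j.
pose F (alpha : {ffun column_set p.+1 n -> nat}) :=
  \prod_B maximal_minor K B ^+ alpha B.
exists (fun alpha : {ffun column_set p.+1 n -> nat} =>
  (C (\sum_B alpha B)%N)^-1 *: F alpha); split.
- move=> alpha; apply: dhomogZ; rewrite /F.
  elim/big_ind2: _ => [|p1 k1 p2 k2|B _]; rewrite ?muln0.
  + exact: dhomog1.
  + by rewrite mulnDr; apply: dhomogM.
  + exact/dhomogMn/maximal_minor_homog.
- rewrite /F big1 ?big1 => [|B _|B _]; rewrite ?ffunE ?expr0 //.
  by rewrite /C big_ord0 invr1 scale1r oner_neq0.
move=> i alpha; case/mxvec_indexP: i => a b.
have sum_succ B : (\sum_A ffun_succ B alpha A = (\sum_A alpha A).+1)%N.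
  under eq_bigr do rewrite ffunE; rewrite big_split /= -[RHS]addn1; congr (_ + _)%N.
  by rewrite (bigD1 B) //= eqxx big1 // => A /negbTE ->.
have F_succ B : F (ffun_succ B alpha) = maximal_minor K B * F alpha.
  rewrite /F (bigD1 B) //= [in RHS](bigD1 B) //= ffunE eqxx addn1 exprS mulrA.
  by congr (_ * _); apply: eq_bigr => A /negbTE nAB; rewrite ffunE nAB addn0.
under [RHS]eq_bigr do rewrite sum_succ F_succ linearZ /=.
rewrite -scaler_sumr (@capelli_minors K p n a b (\sum_B alpha B)%N); last first.
  by apply: polar_eigen_prod => B; rewrite maximal_minorE; apply: polar_eigen_det.
rewrite scalerA -scalerAr; congr (_ *: _).
by rewrite /C big_ord_recr /= invfM -mulrA mulVf ?mulr1 //; exact: nz_c.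
Qed.

Lemma bernstein_sato_pde_root (K : fieldType) N d n (I : finType)
    (f : I -> {mpoly K[N]}) b :
  (0 < d)%N -> d%:R != 0 :> K -> N = (d * n)%N -> polynomial_pde d f ->
  is_bernstein_sato (ideal_gen f) b -> b.[- n%:R] = 0.
Proof.
move=> d_gt0 nz_d eN [f_homog [P [P_homog nz_P P_pde]]] [r' [g [nz_g gen_g [_ rel_b _]]]].
pose f' (k : 'I_#|I|) := f (enum_val k).
pose Q (a : 'X_{1..#|I|}) := P [ffun k => a (enum_rank k)].
(* Both families generate the same ideal, so each is expressed through the other. *)
have [cc f_g] : exists cc : 'I_#|I| -> 'I_r' -> {mpoly K[N]},
    forall k, f' k = \sum_l cc k l * g l.
  apply: (fin_all_exists (U := fun=> 'I_r' -> {mpoly K[N]})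
    (P := fun k u => f' k = \sum_l u l * g l)) => k.
  apply/gen_g; exists (fun j => (j == enum_val k)%:R).
  rewrite (bigD1 (enum_val k)) //= eqxx mul1r big1 ?addr0 // => j /negbTE ->.
  by rewrite mul0r.
have [aa g_f] : exists aa : 'I_r' -> 'I_#|I| -> {mpoly K[N]},
    forall l, g l = \sum_k aa l k * f' k.
  apply: (fin_all_exists (U := fun=> 'I_#|I| -> {mpoly K[N]})
    (P := fun l u => g l = \sum_k u k * f' k)) => l.
  have [|e ->] := (gen_g (g l)).2.
    exists (fun j => (j == l)%:R).
    by rewrite (bigD1 l) //= eqxx mul1r big1 ?addr0 // => j /negbTE ->; rewrite mul0r.
  exists (e \o enum_val); rewrite (reindex (fun k : 'I_#|I| => enum_val k)) //.
  exact/onW_bij/enum_val_bij.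
apply: (@bernstein_sato_rel_root K N _ _ d f' Q _ _ _ d_gt0 g cc aa) => //.
- by move=> k; exact: f_homog.
- move=> a; rewrite mdegE (reindex (@enum_rank I)) /=; last exact/onW_bij/enum_rank_bij.
  by under eq_bigr do rewrite -(ffunE (fun k => a (enum_rank k))); exact: P_homog.
- move=> i a; rewrite /Q P_pde (reindex (fun k : 'I_#|I| => enum_val k)) /=; last first.
    exact/onW_bij/enum_val_bij.
  apply: eq_bigr => k _; congr (diff_op _ (P _)); apply/ffunP => j.
  by rewrite !ffunE mnmDE mnm1E -(inj_eq enum_rank_inj) enum_valK eq_sym.
rewrite /Q (_ : [ffun _ => _] = [ffun=> 0%N]) //.
by apply/ffunP=> j; rewrite !ffunE mnm0E.
Qed.

Theorem theoremB (R : realType) (m n : nat) (hm : (0 < m)%N) (hmn : (m <= n)%N) :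
  polynomial_pde m (@maximal_minor R[i] m n) /\
  (forall b : {poly R[i]},
     is_bernstein_sato (@maximal_minor_ideal R[i] m n) b -> b.[- n%:R] = 0).
Proof.
have pde := maximal_minor_pde R[i] hm hmn; split=> // b.
(* Here d = m and N = m n, so - N / d is - n. *)
by apply: bernstein_sato_pde_root pde; rewrite // pnatr_eq0 -lt0n.
Qed.
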